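(* Suppose $\Lambda\subseteq K\{X_{[n]}\}_{\leq b}$ is autoreduced and reduction-coherent. If $g\in(\Lambda^H_{[d]})\cap K\{X_{[n]}\}_{\leq d}$ is partially reduced with respect to $\Lambda$, then $g\in(\Lambda^H_{(\mathfrak{z}^{b+d}(d,b))})$.
   Context: **Differential setting.** $K$ is a field of characteristic $0$ with a set $\Delta=\{\delta_1,\ldots,\delta_m\}$ ($m\ge1$) of commuting derivations; $\Theta=\{\delta_1^{k_1}\cdots\delta_m^{k_m}\}$; $K\{X_{[n]}\}$ is the differential polynomial ring in $n\ge 1$ differential indeterminates. A derivative is an expression $\theta X_i$, $\theta\in\Theta$. Derivatives are ordered by the orderly ranking: $\delta_1^{k_1}\cdots\delta_m^{k_m}X_r<\delta_1^{l_1}\cdots\delta_m^{l_m}X_s$ iff $(\sum_i k_i,k_1,\ldots,k_m,r)$ is lexicographically smaller than $(\sum_i l_i,l_1,\ldots,l_m,s)$. Let $Z_1<Z_2<\cdots$ list all derivatives in increasing order, so $K\{X_{[n]}\}=K[Z_1,Z_2,\ldots]$. $K\{X_{[n]}\}_{\le b}$ is the set of polynomials in $Z_1,\ldots,Z_b$ of total degree $\le b$. $(S)$ is the ordinary ideal of $K\{X_{[n]}\}$ generated by $S$. For $f\notin K$: the leader $\mu_f$ is the greatest derivative occurring in $f$, and $o(f)=l$ where $\mu_f=Z_l$; the initial $I_f$ is the coefficient of the highest power of $\mu_f$ in $f$; the separant is $S_f=\partial f/\partial\mu_f$. $f$ is partially reduced with respect to $g\notin K$ if no proper derivative of $\mu_g$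 occurs in $f$, and reduced with respect to $g$ if in addition $\deg_{\mu_g}f<\deg_{\mu_g}g$; (partially) reduced with respect to a set means with respect to each of its elements. A set $\Lambda\subseteq K\{X_{[n]}\}\setminus K$ is autoreduced if each of its elements is reduced with respect to every other one (such sets are finite). Put $H_\Lambda=\prod_{\lambda\in\Lambda}I_\lambda S_\lambda$ and, for $k\in\mathbb{N}$, $\Lambda^H_{(k)}=\{g\in K\{X_{[n]}\}_{\le k}\mid H_\Lambda^kg\in(\Lambda)\}$, $\Lambda_{[k]}=\{\theta\lambda\mid\lambda\in\Lambda,\ \theta\in\Theta,\ o(\theta\lambda)\le o(\lambda)+k\}$, $\Lambda^H_{[k]}=\{g\in K\{X_{[n]}\}_{\le k}\mid H_\Lambda^kg\in(\Lambda_{[k]})\}$. Pseudodivision: a remainder of $f$ with respect to an autoreduced set $\Lambda$ is obtained by repeating, until the current polynomial $r$ is reduced with respect to $\Lambda$, the following step: take the highest-ranking derivative $v$ in $r$ that prevents $r$ from being reduced with respect to some $\lambda\in\Lambda$; with $e=\deg_v r$ and $c$ the coefficient of $v^e$ in $r$, replace $r$ by $S_\lambda r-c\,v^{e-1}\theta\lambda$ if $v=\theta\mu_\lambda$ is a proper derivative of $\mu_\lambda$, or by $I_\lambda r-c\,v^{e-\deg_v\lambda}\lambda$ if $v=\mu_\lambda$. $f$ reduces to $0$ with respect to $\Lambda$ if the remainder is $0$. For $f,g\notin K$ and $\theta_f,\theta_g\in\Theta$ such that $\theta_gf$ and $\theta_fg$ have the same leader $v$, the $\Delta$-$S$-polynomial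 is $\Delta(f,g,v)=S_g\theta_gf-S_f\theta_fg$. An autoreduced set $\Lambda$ is reduction-coherent if for all $f,g\in\Lambda$ with derivatives that share a common leader $v$, $\Delta(f,g,v)$ reduces to $0$ with respect to $\Lambda$. **Bounding functions.** $\mathfrak{d}_r(b)=(2b)^{2^r}$; $\mathfrak{g}(b,d)=d(1+b)^d$; $\mathfrak{z}^0(d,b)=d$ and, with $G=\mathfrak{g}(b+d-1,\max\{b+d-1,2b\})$, $\mathfrak{z}^{k+1}(d,b)=\mathfrak{z}^k\left(\mathfrak{d}_{b+d}\left((G+d+1)\binom{2b}{b}2b+d\right)+G+d+1,\ b\right)$. *)

(* Defs.v *)
From mathcomp Require Import all_boot all_order all_algebra finmap.
From mathcomp.multinomials Require Export monalg.

Set Implicit Arguments.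
Unset Strict Implicit.
Unset Printing Implicit Defensive.

Import Order.TTheory GRing.Theory.

Local Open Scope fset_scope.
Local Open Scope ring_scope.

Definition ideal_gen (A : comNzRingType) (S : A -> Prop) (f : A) : Prop :=
  exists s : seq (A * A),
    (forall p, p \in s -> S p.2) /\ f = \sum_(p <- s) p.1 * p.2.

Definition is_derivation (A : pzRingType) (D : A -> A) : Prop :=
  (forall x y, D (x + y) = D x + D y) /\
  (forall x y, D (x * y) = D x * y + x * D y).

(* The element delta_1^k_1 ... delta_m^k_m of the free commutative monoid
   Theta is the monomial k : {cmonom 'I_m}; the derivative theta X_r is the
   pair (theta, r). *)
Definition Theta (m : nat) := {cmonom 'I_m}.
Definition derivative (m n : nat) : choiceType := (Theta m * 'I_n)%type.
Definition dmonom (m n : nat) := {cmonom derivative m n}.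
Definition dpoly (K : fieldType) (m n : nat) : comNzRingType :=
  {malg K[dmonom m n]}.

Section Derivatives.
Context {m n : nat}.
Implicit Types v w : derivative m n.

Definition dact (t : Theta m) v : derivative m n := (mmul t v.1, v.2).

Definition proper_derivative_of v w : Prop :=
  exists t : Theta m, t <> mone /\ v = dact t w.

Definition lexkey (k : 'I_m -> nat) (r : 'I_n) : seqlexi nat :=
  (\sum_(i < m) k i)%N :: rcons [seq k i | i <- enum 'I_m] (r : nat).

Definition rank v : seqlexi nat := lexkey (fun i => v.1 i) v.2.

(* The l such that v = Z_l, that is, the number of derivatives w <= v.  Such
   a w has order at most the order of v, so all its exponents are bounded by
   it.  See [ovar_lt] and [ovar_surj]. *)
Definition ovar v : nat :=
  #|[set w : {ffun 'I_m -> 'I_(\sum_(i < m) v.1 i)%N.+1} * 'I_n |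
      (lexkey (fun i => w.1 i) w.2 <= rank v)%O]|.

Lemma rank_inj : injective rank.
Proof.
case=> [k r] [k' r'] [_] /rcons_inj[/eq_in_map kE /val_inj <-]; congr pair.
by apply/eqP/cmP => i; apply: kE; rewrite mem_enum.
Qed.

Lemma ovar_enum v : exists s : seq (derivative m n),
  [/\ uniq s, size s = ovar v & forall w, (w \in s) = (rank w <= rank v)%O].
Proof.
pose N := (\sum_(i < m) v.1 i)%N.
pose dec (w : {ffun 'I_m -> 'I_N.+1} * 'I_n) : derivative m n :=
  ([cmonom (w.1 i : nat) | i in [fset i | i in 'I_m]]%M, w.2).
have decE x i : (dec x).1 i = x.1 i by rewrite cmE fsfun_fun in_fset.
have rank_dec x : rank (dec x) = lexkey (fun i => x.1 i) x.2.
  rewrite /rank /lexkey (eq_bigr _ (fun i _ => decE x i)).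
  by rewrite (eq_map (decE x)).
have dec_inj : injective dec.
  move=> [k r] [k' r'] /[dup] /(congr1 fst) kE /(congr1 snd) /= ->.
  congr pair; apply/ffunP => i; apply/val_inj.
  by have := decE (k, r) i; rewrite kE decE.
set S := [set w : {ffun 'I_m -> 'I_N.+1} * 'I_n |
            (lexkey (fun i => w.1 i) w.2 <= rank v)%O].
exists [seq dec x | x <- enum S]; split=> [||w].
- by rewrite map_inj_uniq ?enum_uniq.
- by rewrite size_map -cardE.
apply/mapP/idP => [[w' + ->]|]; first by rewrite mem_enum inE rank_dec.
move=> wv; have wN i : (w.1 i < N.+1)%N.
  rewrite ltnS; move: wv; rewrite /rank /lexkey lexi_cons => /andP[+ _].
  by apply: leq_trans; rewrite (bigD1 i) //= leq_addr.
have wE : w = dec ([ffun i => inord (w.1 i)], w.2).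
  case: w {wv} wN => [k r] wN; congr pair; apply/eqP/cmP => i.
  by rewrite (decE (_, r)) ffunE inordK.
by exists ([ffun i => inord (w.1 i)], w.2);
  rewrite // mem_enum inE -rank_dec -wE.
Qed.

Lemma ovar_lt v w : (ovar v < ovar w)%N = (rank v < rank w)%O.
Proof.
have lt v1 v2 : (rank v1 < rank v2)%O -> (ovar v1 < ovar v2)%N.
  have [s1 [u1 <- m1]] := ovar_enum v1; have [s2 [_ <- m2]] := ovar_enum v2.
  move=> lt12; apply: (@uniq_leq_size _ (v2 :: s1)).
    by rewrite /= m1 leNgt lt12.
  move=> x; rewrite inE => /predU1P[->|]; first by rewrite m2.
  by rewrite m1 m2 => /le_trans -> //; apply: ltW.
have [|/lt/ltnW|/rank_inj->] := ltgtP (rank v) (rank w); first exact: lt.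
  by rewrite leqNgt => /negbTE.
by rewrite ltnn.
Qed.

Lemma ovar_surj : (0 < m)%N -> (0 < n)%N ->
  forall l, (0 < l)%N -> exists v, ovar v = l.
Proof.
move=> m_gt0 n_gt0 l l_gt0.
have [v lv] : exists v, (l <= ovar v)%N.
  pose i0 := Ordinal m_gt0.
  pose z j : derivative m n := (iter j (mmul (ucm i0)) mone, Ordinal n_gt0).
  exists (z l); elim: {l_gt0} l => [|l IHl] //; apply: leq_ltn_trans IHl _.
  rewrite ovar_lt /rank /lexkey ltxi_cons; apply/andP.
  have: (\sum_(i < m) (z l).1 i < \sum_(i < m) (z l.+1).1 i)%N.
    rewrite [X in (_ < X)%N](eq_bigr (fun i => (i0 == i) + (z l).1 i)%N).
      rewrite big_split /= [X in (_ < X + _)%N](bigD1 i0) //= ?eqxx.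
      by rewrite -addnA add1n ltnS leq_addl.
    by move=> i _; rewrite cmM cmU.
  by move=> lt; split; [apply: ltnW|apply/implyP; rewrite leEnat leqNgt lt].
have [s [us ss ms]] := ovar_enum v.
have u : uniq [seq ovar w | w <- s].
  rewrite map_inj_in_uniq // => x y _ _ xy; apply: rank_inj; apply: le_anti.
  by rewrite !leNgt -!ovar_lt xy ltnn.
have sub : {subset [seq ovar w | w <- s] <= iota 1 (ovar v)}.
  move=> _ /mapP[w + ->]; rewrite ms mem_iota add1n ltnS => wv.
  rewrite [X in _ && X]leqNgt ovar_lt -leNgt wv andbT.
  have [[|x s'] [_ <- mw]] := ovar_enum w => //.
  by have := mw w; rewrite lexx in_nil.
have sz : (size (iota 1 (ovar v)) <= size [seq ovar w | w <- s])%N.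
  by rewrite size_iota size_map ss.
have: l \in [seq ovar w | w <- s].
  by rewrite (uniq_min_size u sub sz).2 mem_iota l_gt0 add1n ltnS.
by case/mapP => w _ ->; exists w.
Qed.

End Derivatives.

Section Polynomials.
Context {K : fieldType} {m n : nat}.
Implicit Types (f g : dpoly K m n) (v w : derivative m n).

Definition is_constant f : Prop := exists c : K, f = malgC c.

Definition vars f : {fset derivative m n} :=
  \bigcup_(u <- msupp f) finsupp (u : dmonom m n).

Definition degv v f : nat := (\max_(u <- msupp f) (u : dmonom m n) v)%N.

Definition dvar v : dpoly K m n := << ucm v >>.

(* The coefficient of v^e in f, as a polynomial in the other derivatives. *)
Definition coefv v (e : nat) f : dpoly K m n :=
  \sum_(u <- msupp f | (u : dmonom m n) v == e)
     << f@_u *g [cmonom (u : dmonom m n) w | w in finsupp u `\ v]%M >>.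

(* The partial derivative of f with respect to v. *)
Definition partial v f : dpoly K m n :=
  \sum_(u <- msupp f) << f@_u *+ (u : dmonom m n) v *g divcm u (ucm v) >>.

(* K{X}_{<= b}; [msize] is the total degree plus one, and 0 at f = 0. *)
Definition bounded (b : nat) f : Prop :=
  (forall v, v \in vars f -> (ovar v <= b)%N) /\ (msize f <= b.+1)%N.

(* [None] exactly when f is constant. *)
Definition leader f : option (derivative m n) :=
  ohead [seq v <- vars f | all (fun w => (rank w <= rank v)%O) (vars f)].

(* The next three functions are only meaningful at a non-constant f. *)
Definition opol f : nat := if leader f is Some v then ovar v else 0%N.

Definition initial f : dpoly K m n :=
  if leader f is Some v then coefv v (degv v f) f else 0.

Definition separant f : dpoly K m n :=
  if leader f is Some v then partial v f else 0.

Definition partially_reduced f g : Prop :=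
  forall v, leader g = Some v ->
  forall w, proper_derivative_of w v -> w \notin vars f.

Definition reduced f g : Prop :=
  partially_reduced f g /\
  forall v, leader g = Some v -> (degv v f < degv v g)%N.

Implicit Type L : {fset dpoly K m n}.

Definition partially_reduced_set f L : Prop :=
  forall l, l \in L -> partially_reduced f l.

Definition reduced_set f L : Prop := forall l, l \in L -> reduced f l.

Definition autoreduced L : Prop :=
  (forall l, l \in L -> ~ is_constant l) /\
  (forall l l', l \in L -> l' \in L -> l <> l' -> reduced l l').

Definition HL L : dpoly K m n := \prod_(l <- L) (initial l * separant l).

(* The derivations of K{X}, for given derivations delta_i of K. *)
Section Derivations.
Variable delta : 'I_m -> K -> K.

(* The derivation of K{X} that extends delta_i and maps the derivative v to
   delta_i v: apply delta_i to the coefficients and add the chain rule. *)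
Definition pder (i : 'I_m) f : dpoly K m n :=
  \sum_(u <- msupp f) << delta i f@_u *g u >>
  + \sum_(v <- vars f) partial v f * dvar (dact (ucm i) v).

Definition theta_act (t : Theta m) f : dpoly K m n :=
  foldr (fun i h => iter (t i) (pder i) h) f (enum 'I_m).

(* v prevents r from being reduced with respect to l. *)
Definition obstructs v r l : Prop :=
  exists2 mu, leader l = Some mu &
    (proper_derivative_of v mu /\ v \in vars r) \/
    (v = mu /\ (degv v l <= degv v r)%N).

Variant rem_step L r : dpoly K m n -> Prop :=
| RemStepProper v l mu t of
    l \in L & obstructs v r l
    & (forall w l', l' \in L -> obstructs w r l' -> (rank w <= rank v)%O)
    & leader l = Some mu & t <> mone & v = dact t mu :
    rem_step L r
      (separant l * r
       - coefv v (degv v r) r * dvar v ^+ (degv v r).-1 * theta_act t l)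
| RemStepLeader v l of
    l \in L & obstructs v r l
    & (forall w l', l' \in L -> obstructs w r l' -> (rank w <= rank v)%O)
    & leader l = Some v :
    rem_step L r
      (initial l * r
       - coefv v (degv v r) r * dvar v ^+ (degv v r - degv v l) * l).

Inductive rem_steps L r : dpoly K m n -> Prop :=
| RemDone : rem_steps L r r
| RemMore r' r'' of rem_step L r r' & rem_steps L r' r'' : rem_steps L r r''.

Definition remainder L f r : Prop := rem_steps L f r /\ reduced_set r L.

(* Remainders depend on the choice of l at each step; f reduces to 0 if one
   of its remainders is 0. *)
Definition reduces_to_0 L f : Prop := remainder L f 0.

Definition Spoly f g (tf tg : Theta m) : dpoly K m n :=
  separant g * theta_act tg f - separant f * theta_act tf g.

Definition reduction_coherent L : Prop :=
  forall f g, f \in L -> g \in L ->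
  forall (tf tg : Theta m) v,
    leader (theta_act tg f) = Some v -> leader (theta_act tf g) = Some v ->
    reduces_to_0 L (Spoly f g tf tg).

(* Lambda_[k] *)
Definition Lprolong L (k : nat) (h : dpoly K m n) : Prop :=
  exists l t, [/\ l \in L, (opol (theta_act t l) <= opol l + k)%N
                & h = theta_act t l].

(* Lambda^H_(k) *)
Definition LHalg L (k : nat) g : Prop :=
  bounded k g /\ ideal_gen (fun h => h \in L) (HL L ^+ k * g).

(* Lambda^H_[k] *)
Definition LHdiff L (k : nat) g : Prop :=
  bounded k g /\ ideal_gen (Lprolong L k) (HL L ^+ k * g).

End Derivations.
End Polynomials.

Section Bounds.
Local Open Scope nat_scope.

Definition dbound (r b : nat) : nat := (2 * b) ^ (2 ^ r).

Definition gbound (b d : nat) : nat := d * (1 + b) ^ d.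

(* The subtraction b + d - 1 is truncated only for b = d = 0, and
   zbound (b + d) d b = d without any unfolding in that case. *)
Fixpoint zbound (k d b : nat) : nat :=
  if k is k'.+1 then
    let G := gbound (b + d - 1) (maxn (b + d - 1) (2 * b)) in
    zbound k' (dbound (b + d) ((G + d + 1) * 'C(2 * b, b) * (2 * b) + d)
               + G + d + 1) b
  else d.

End Bounds.

(* Main.v *)
From HB Require Import structures.
From Stdlib Require Import Classical.
Require Import Defs.
From mathcomp Require Import all_boot all_order all_algebra finmap.
From mathcomp Require Import zify ring.
From mathcomp.multinomials Require Import monalg.

(** Write [h] for [HL L].  The hypothesis on [g] says that [h ^+ d * g] lies in
    the ideal generated by finitely many derivatives of elements of [L].  It is
    enough to find a power of [h], with an exponent at most [zbound (b + d) d b],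
    that multiplies [g] into the ideal generated by [L] itself: [g] is then one of
    the generators of the ideal in the conclusion.  This is done in two
    independent steps.

    The first step is Rosenfeld's lemma, [rosenfeld], without any control of the
    exponent.  The derivatives of elements of [L] are discarded by decreasing
    leader ([rosenfeld_step]).  Let [v] be the highest leader of the proper
    derivatives that are left.  Those with that leader have the form
    [separant l * v + a] with [a] free of [v] ([theta_act_top]); by coherence and
    [rem_steps_satur], up to a power of [h] and modulo lower derivatives, all of
    them are multiples of a single one.  Neither [g], nor [h], nor any of the
    remaining generators involves [v], so that the linear relation that is left
    can be eliminated ([linear_elimination]).

    The second step, [triangular_saturation], forgets the derivations.  Sorted by
    leader, [L] is a triangular system: each element involves its leader [x], of
    which it is a polynomial with initial [q], and otherwise only lower
    derivatives.  The claim is that if some power of [h] multiplies [g] into the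
    ideal of the system, then an explicit one does.

    If the elements are monic in their leaders, the exponent does not depend on
    [g] at all: modulo a monic polynomial of degree [D], every element is a root
    of a monic polynomial of degree [D] over the coefficients, and reading this
    equation coefficient by coefficient turns an exponent [k] for the coefficients
    into the exponent [D * (1 + D * k)] ([torsion_exponent_monic]).  The descent
    ends in a domain, where the exponent is 1 ([torsion_exponent_zero]).

    In general, the substitution of [q * x] for [x] makes the lowest element
    monic, up to a power of [q]; a polynomial [f] of degree at most [e] in [x] is
    carried back by the homogenization [rescale], since [q ^+ e * f] is the image
    of [rescale f].  As [q] divides [h], this costs a factor and a summand in the
    exponent, which are governed by the degrees of [h], [g] and the system in the
    leaders.  As [q] does not involve the later leaders, those degrees do not grow
    in the process.  The exponent that results is at most
    [(2 * b) ^ (4 * b) * d.+1], which is already below a single unfolding of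
    [zbound] ([double_exponent_le_zbound]). *)

Set Implicit Arguments.
Unset Strict Implicit.
Unset Printing Implicit Defensive.

Import Order.TTheory GRing.Theory.

(** * Ideals, saturations and elimination of a linear variable *)

Section RingIdentities.
Local Open Scope ring_scope.

Lemma polyCX_mul (A : comNzRingType) (a b : A) i j :
  ((a * b)%:P * 'X^(i + j) = (a%:P * 'X^i) * (b%:P * 'X^j))%R.
Proof. by rewrite exprD polyCM mulrACA. Qed.

Lemma polyC_mulA (A : comNzRingType) (a b : A) p :
  (a%:P * (b%:P * p) = (a * b)%:P * p)%R.
Proof. by rewrite polyCM mulrA. Qed.

Lemma horner_CXn (A : comNzRingType) (a x : A) i :
  ((a%:P * 'X^i).[x] = a * x ^+ i)%R.
Proof. by rewrite !hornerE. Qed.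

Lemma coef_CXn (A : comNzRingType) (a : A) i l :
  ((a%:P * 'X^i)`_l = if l == i then a else 0)%R.
Proof. by rewrite coefCM coefXn; case: eqP; rewrite (mulr1, mulr0). Qed.

Lemma coef_rmorph_sum (A : comNzRingType) (r : {rmorphism A -> {poly A}})
    (T : Type) (s : seq T) (F : T -> A) l :
  ((r (\sum_(i <- s) F i))`_l = \sum_(i <- s) (r (F i))`_l)%R.
Proof. by rewrite rmorph_sum coef_sum. Qed.

Lemma addr_subKC (V : zmodType) (x y : V) : (y + (x - y) = x)%R.
Proof. by rewrite addrC subrK. Qed.

Lemma cross_cancel (A : comNzRingType) (s s0 x a a0 : A) :
  (s0 * (s * x + a) - s * (s0 * x + a0) = s0 * a - s * a0)%R.
Proof. by ring. Qed.

Lemma mulr_swap (A : comNzRingType) (x y z : A) : (x * y * z = y * (x * z))%R.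
Proof. by ring. Qed.

End RingIdentities.

Section Ideals.
Local Open Scope ring_scope.
Context {A : comNzRingType}.
Implicit Types (I J : A -> Prop) (a b f h x y : A).

Record ideal I : Prop := Ideal {
  ideal_0 : I 0;
  ideal_add : forall x y, I x -> I y -> I (x + y);
  ideal_mull : forall a x, I x -> I (a * x) }.

Lemma ideal_mulr I a x : ideal I -> I x -> I (x * a).
Proof. by move=> idI Ix; rewrite mulrC; apply: ideal_mull. Qed.

Lemma ideal_opp I x : ideal I -> I x -> I (- x).
Proof. by move=> idI Ix; rewrite -mulN1r; apply: ideal_mull. Qed.

Lemma ideal_sub I x y : ideal I -> I x -> I y -> I (x - y).
Proof. by move=> idI Ix Iy; apply: ideal_add => //; apply: ideal_opp. Qed.

Lemma ideal_sum I (T : eqType) (r : seq T) (P : pred T) (F : T -> A) :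
  ideal I -> (forall i, i \in r -> P i -> I (F i)) -> I (\sum_(i <- r | P i) F i).
Proof.
move=> idI; elim: r => [|i r IHr] IF; first by rewrite big_nil; apply: ideal_0.
have IFr : I (\sum_(i <- r | P i) F i).
  by apply: IHr => j jr; apply: IF; rewrite inE jr orbT.
rewrite big_cons; case: ifP => // Pi.
by apply: ideal_add => //; apply: IF => //; rewrite mem_head.
Qed.

Lemma ideal_subK I x y : ideal I -> I (x - y) -> I y -> I x.
Proof. by move=> idI Ixy Iy; rewrite -(subrK y x); apply: ideal_add. Qed.

Lemma zero_ideal : ideal (eq^~ (0 : A)).
Proof. by split=> // [x y -> ->|a x ->]; rewrite ?addr0 ?mulr0. Qed.

Lemma ideal_congM I x x' y y' :
  ideal I -> I (x - x') -> I (y - y') -> I (x * y - x' * y').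
Proof.
move=> idI Ix Iy; have -> : x * y - x' * y' = y * (x - x') + x' * (y - y').
  by rewrite !mulrBr addrA ![y * _]mulrC subrK.
by apply: ideal_add => //; apply: ideal_mull.
Qed.

Lemma ideal_congX I x x' k : ideal I -> I (x - x') -> I (x ^+ k - x' ^+ k).
Proof. by move=> idI Ix; rewrite subrXX; apply: ideal_mulr. Qed.

Lemma ideal_expr_le I x f j k :
  ideal I -> (j <= k)%N -> I (x ^+ j * f) -> I (x ^+ k * f).
Proof.
by move=> idI /subnK <- Ixf; rewrite exprD -mulrA; apply: ideal_mull.
Qed.

Lemma ideal_gen_ideal (S : A -> Prop) : ideal (ideal_gen S).
Proof.
split=> [|x y [s [sS ->]] [s' [sS' ->]]|a x [s [sS ->]]].
- by exists [::]; rewrite big_nil.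
- exists (s ++ s'); rewrite big_cat; split=> // p.
  by rewrite mem_cat => /orP[/sS|/sS'].
- exists [seq (a * p.1, p.2) | p <- s]; split=> [p /mapP[q /sS Sq ->] //|].
  by rewrite big_map mulr_sumr; apply: eq_bigr => p _; rewrite mulrA.
Qed.

Lemma ideal_gen_mem (S : A -> Prop) x : S x -> ideal_gen S x.
Proof.
by exists [:: (1, x)]; split=> [p|]; rewrite ?big_seq1 ?mul1r // inE => /eqP->.
Qed.

Lemma ideal_gen_least (S I : A -> Prop) :
  ideal I -> (forall x, S x -> I x) -> forall x, ideal_gen S x -> I x.
Proof.
move=> idI SI _ [s [sS ->]]; apply: ideal_sum => // p ps _.
by apply: ideal_mull => //; apply/SI/sS.
Qed.

Definition adjoin I a x := exists q, I (x - q * a).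

Lemma adjoin_ideal I a : ideal I -> ideal (adjoin I a).
Proof.
move=> idI; split=> [|x y [q Ix] [q' Iy]|b x [q Ix]].
- by exists 0; rewrite mul0r subr0; apply: ideal_0.
- by exists (q + q'); rewrite mulrDl opprD addrACA; apply: ideal_add.
- by exists (b * q); rewrite -mulrA -mulrBr; apply: ideal_mull.
Qed.

Lemma adjoin_sub I a x : I x -> adjoin I a x.
Proof. by move=> Ix; exists 0; rewrite mul0r subr0. Qed.

Lemma adjoin_mem I a : ideal I -> adjoin I a a.
Proof. by move=> idI; exists 1; rewrite mul1r subrr; apply: ideal_0. Qed.

Lemma adjoin_least I J a :
  ideal J -> (forall x, I x -> J x) -> J a -> forall x, adjoin I a x -> J x.
Proof.
move=> idJ IJ Ja x [q /IJ Jx]; rewrite -(subrK (q * a) x).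
by apply: ideal_add => //; apply: ideal_mull.
Qed.

Definition satur h I x := exists k, I (h ^+ k * x).

Lemma satur_ideal h I : ideal I -> ideal (satur h I).
Proof.
move=> idI; split=> [|x y [j Ix] [k Iy]|a x [k Ix]].
- by exists 0%N; rewrite mulr0; apply: ideal_0.
- exists (j + k)%N; rewrite mulrDr; apply: ideal_add => //.
    by apply: ideal_expr_le Ix => //; apply: leq_addr.
  by apply: ideal_expr_le Iy => //; apply: leq_addl.
- by exists k; rewrite mulrCA; apply: ideal_mull.
Qed.

Lemma colon_power_ideal h k I : ideal I -> ideal (fun x => I (h ^+ k * x)).
Proof.
move=> idI; split=> [|x y Ix Iy|a x Ix].
- by rewrite mulr0; apply: ideal_0.
- by rewrite mulrDr; apply: ideal_add.
- by rewrite mulrCA; apply: ideal_mull.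
Qed.

Lemma satur_expr h I x k : satur h I (h ^+ k * x) -> satur h I x.
Proof. by case=> j; exists (j + k)%N; rewrite exprD -mulrA. Qed.

Lemma satur_expr_factor h h1 h2 I x k :
  ideal I -> h = h1 * h2 -> I (h1 ^+ k * x) -> satur h I x.
Proof.
move=> idI -> Ix; exists k; rewrite exprMn [_ * h2 ^+ k]mulrC -mulrA.
exact: ideal_mull.
Qed.

Lemma satur_sub h I x : I x -> satur h I x.
Proof. by exists 0%N; rewrite mul1r. Qed.

Lemma satur_satur h I x : satur h (satur h I) x -> satur h I x.
Proof. by case=> j [k]; exists (k + j)%N; rewrite exprD -mulrA. Qed.

Lemma satur_sub_satur h I J :
  (forall x, I x -> satur h J x) -> forall x, satur h I x -> satur h J x.
Proof. by move=> IJ x [k /IJ IJx]; apply: satur_satur; exists k. Qed.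

Lemma satur_cancel h h1 h2 I x :
  ideal I -> h = h1 * h2 -> satur h I (h1 * x) -> satur h I x.
Proof.
move=> idI hE [k Ix]; exists k.+1; rewrite exprSr {2}hE -mulrA [h1 * h2]mulrC.
by rewrite -mulrA mulrCA; apply: ideal_mull.
Qed.

End Ideals.

Section PolynomialIdeals.
Local Open Scope ring_scope.
Context {A : comNzRingType}.
Implicit Types (I : A -> Prop) (p q : {poly A}).

Definition polyideal I p := forall i, I p`_i.

Lemma polyideal_ideal I : ideal I -> ideal (polyideal I).
Proof.
move=> idI; split=> [i|p q Ip Iq i|p q Iq i].
- by rewrite coef0; apply: ideal_0.
- by rewrite coefD; apply: ideal_add.
- by rewrite coefM; apply: ideal_sum => // j _ _; apply: ideal_mull.
Qed.

Lemma polyideal_horner I p x : ideal I -> polyideal I p -> I p.[x].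
Proof.
move=> idI Ip; rewrite horner_coef; apply: ideal_sum => // i _ _.
exact: ideal_mulr.
Qed.

Lemma polyidealC I c : ideal I -> I c -> polyideal I c%:P.
Proof. by move=> idI Ic [|i]; rewrite coefC //=; apply: ideal_0. Qed.

(** This replaces the substitution of [- t / s] for the variable, which
    would need fractions: reading the relation from the highest coefficient
    of [p] downwards, each coefficient of [p] is killed modulo [I] by a power
    of [s], and the constant term of the relation says that, modulo [I], [c] is
    [t] times the last of them. *)
Lemma linear_elimination I c s t p : ideal I ->
  polyideal I (c%:P - p * (s%:P * 'X + t%:P)) -> exists k, I (s ^+ k * c).
Proof.
move=> idI Ip.
have coefE i : (p * (s%:P * 'X + t%:P))`_i.+1 = s * p`_i + t * p`_i.+1.
  by rewrite mulrDr mulrA coefD coefMX !coefMC /= !(mulrC p`__).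
have kill j i : (size p <= i + j)%N -> I (s ^+ j * p`_i).
  elim: j i => [|j IHj] i lepi.
    by rewrite addn0 in lepi; rewrite nth_default // mulr0; apply: ideal_0.
  have := Ip i.+1; rewrite coefB coefC coefE sub0r => /ideal_opp -/(_ idI).
  rewrite opprK => Ii.
  have -> : s ^+ j.+1 * p`_i =
      s ^+ j * (s * p`_i + t * p`_i.+1) - t * (s ^+ j * p`_i.+1).
    by rewrite mulrDr [s ^+ j * (t * _)]mulrCA addrK exprSr -mulrA.
  apply: ideal_sub => //; apply: ideal_mull => //.
  by apply: IHj; rewrite addSnnS.
exists (size p); have := Ip 0.
rewrite coefB coefC mulrDr mulrA coefD coefMX !coefMC /= add0r => I0.
rewrite -(subrK (p`_0 * t) c) mulrDr; apply: ideal_add => //.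
  exact: ideal_mull.
by rewrite mulrA; apply: ideal_mulr => //; apply: kill; rewrite add0n.
Qed.

End PolynomialIdeals.

(** * Uniform torsion exponents of monic extensions *)

Section TorsionExponent.
Local Open Scope ring_scope.

(** The exponent [k] serves all elements [a] and [f] at once.  In a domain, the
    zero ideal has exponent 1. *)
Definition torsion_exponent (A : comNzRingType) (k : nat) (I : A -> Prop) :=
  forall a f N, I (a ^+ N * f) -> I (a ^+ k * f).

Lemma ideal_exprB (A : comNzRingType) (I : A -> Prop) x y f i j : ideal I ->
  I (x ^+ i * f) -> I (y ^+ j * f) -> I ((x - y) ^+ (i + j) * f).
Proof.
move=> idI Ix Iy; rewrite exprBn mulr_suml; apply: ideal_sum => // l _ _.
rewrite mulrnAl -mulr_natr. apply: ideal_mulr => //.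
have [lej|/ltnW lejl] := leqP l j.
  rewrite mulrAC -(mulrA _ (x ^+ _) f) mulrAC.
  by apply: ideal_mull => //; apply: (ideal_expr_le idI _ Ix);
     rewrite -addnBA ?leq_addr.
by rewrite -(mulrA _ (y ^+ l) f); apply: ideal_mull => //;
   apply: (ideal_expr_le idI lejl Iy).
Qed.

(** Peel off the constant coefficient: if [p = q * 'X + c], then
    [c = p.[a] - q.[a] * a], so an element killed by powers of both [a] and
    [p.[a]] is killed by a power of [c], hence by the power [k] of [c].  Then
    [q.[a] * a = p.[a] - c] has a controlled power that kills it too.  At the
    end of the descent, the polynomial is [1]. *)
Lemma torsion_of_monic_value (A : comNzRingType) (J : A -> Prop) k a N
  (p : {poly A}) : ideal J ->
  (forall i f M, J (p`_i ^+ M * f) -> J (p`_i ^+ k * f)) -> p \is monic ->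
  forall n f, J (p.[a] ^+ n * f) -> J (a ^+ N * f) ->
  J (a ^+ ((size p).-1 * (n + (size p).-1 * k)) * f).
Proof.
move=> idJ; elim/poly_ind: p => [|p c IHp] torc.
  by rewrite monicE lead_coef0 eq_sym oner_eq0.
have [->|p0] := eqVneq p 0.
  rewrite mul0r add0r monicE lead_coefC => /eqP-> n f.
  by rewrite hornerC expr1n !mul1r size_polyC oner_eq0 mul0n mul1r.
have sz : (size c%:P < size (p * 'X)%R)%N.
  by rewrite size_mulX // ltnS (leq_trans (size_polyC_leq1 c)) // size_poly_gt0.
rewrite monicE lead_coefDl // lead_coefMX -monicE => monp n f Jpn JN.
have {}IHp := IHp _ monp; rewrite size_polyDl // size_mulX //.
have coefp i : (p * 'X + c%:P)`_i.+1 = p`_i.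
  by rewrite coefD coefMX coefC addr0.
move: Jpn; set x := _.[a] => Jpn.
have xE : x = p.[a] * a + c by rewrite /x !hornerE.
have Jc : J (c ^+ k * f).
  have := torc 0%N f (n + N)%N; rewrite coefD coefMX coefC add0r /=; apply.
  rewrite -(addrK (p.[a] * a) c) [c + _]addrC -xE.
  by apply: ideal_exprB => //; rewrite exprMn -mulrA; apply: ideal_mull.
have Jpa : J (p.[a] ^+ (n + k) * (a ^+ (n + k) * f)).
  by rewrite mulrA -exprMn -(addrK c (_ * a)) -xE; apply: ideal_exprB.
have torp i g M : J (p`_i ^+ M * g) -> J (p`_i ^+ k * g).
  by have := torc i.+1 g M; rewrite coefp.
have := IHp torp _ _ Jpa; rewrite mulrCA => /(_ (ideal_mull idJ _ JN)).
rewrite mulrA -exprD; apply: ideal_expr_le => //.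
have: (0 < size p)%N by rewrite size_poly_gt0.
by case: (size p) => // D _ /=; nia.
Qed.

(** Modulo the monic [mu], multiplication by [a] has a matrix over [A] in the
    basis of the powers of ['X]; the adjugate of its characteristic matrix
    turns the relations that define it into this equation for [a]. *)
Lemma integral_equation_modulo_monic (A : comNzRingType) (mu a : {poly A}) :
  mu \is monic ->
  exists2 c : {poly A}, c \is monic &
    size c = size mu /\ exists w, c \Po a = w * mu.
Proof.
move=> monmu; case szmu : (size mu) => [|[|D]].
- by have := monic_neq0 monmu; rewrite -size_poly_eq0 szmu.
- exists 1; rewrite ?monic1 // size_poly1; split=> //; exists 1.
  rewrite rmorph1 mul1r; move: monmu; rewrite (size1_polyC (eq_leq szmu)).
  by rewrite monicE lead_coefC => /eqP->.
pose N : 'M[A]_D.+1 := \matrix_(i, j) (Pdiv.Ring.rmodp ('X^i * a) mu)`_j.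
pose v : 'cV[{poly A}]_D.+1 := \col_i 'X^i.
pose w : 'cV[{poly A}]_D.+1 := \col_i Pdiv.Ring.rdivp ('X^i * a) mu.
pose M : 'M[{poly A}]_D.+1 := a%:M - map_mx polyC N.
exists (char_poly N); first exact: char_poly_monic.
split; first exact: size_char_poly.
have MvE : M *m v = mu *: w.
  apply/colP => i; rewrite mulmxBl mul_scalar_mx !mxE.
  rewrite (eq_bigr (fun j : 'I_D.+1 =>
    (Pdiv.Ring.rmodp ('X^i * a) mu)`_j *: 'X^j)); last first.
    by move=> j _; rewrite !mxE mul_polyC.
  have := Pdiv.RingMonic.rdivp_eq monmu ('X^i * a).
  set r := Pdiv.Ring.rmodp _ _ => eqa.
  have szr : (size r <= D.+1)%N.
    by rewrite -ltnS -szmu Pdiv.Ring.ltn_rmodp monic_neq0.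
  rewrite -poly_def; have -> : \poly_(j < D.+1) r`_j = r.
    apply/polyP => j; rewrite coef_poly; case: ltnP => // lejD.
    by rewrite nth_default // (leq_trans szr).
  by rewrite [a * _]mulrC {1}eqa addrK mulrC.
have detE : char_poly N \Po a = \det M.
  rewrite /char_poly -[LHS]/(comp_poly a _) -det_map_mx; congr (\det _).
  apply/matrixP => i j; rewrite !mxE.
  by rewrite rmorphB rmorphMn /= comp_polyX comp_polyC.
exists ((\adj M *m w) 0 0); rewrite detE.
have := congr1 (fun u => (\adj M *m u) 0 0) MvE.
rewrite mulmxA mul_adj_mx mul_scalar_mx -scalemxAr !mxE mulr1 => ->.
by rewrite mulrC.
Qed.


(** Division by the monic [mu] replaces [f] by a remainder, which lies in the
    ideal generated by [I] and [mu] only if all its coefficients lie in [I]. *)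
Lemma torsion_exponent_constants (A : comNzRingType) (I : A -> Prop) k
    (mu : {poly A}) (c : A) (f : {poly A}) N :
  ideal I -> torsion_exponent k I -> mu \is monic ->
  adjoin (polyideal I) mu (c%:P ^+ N * f) ->
  adjoin (polyideal I) mu (c%:P ^+ k * f).
Proof.
move=> idI torI monmu [q Iq].
pose r := Pdiv.Ring.rmodp f mu.
have fE : f = Pdiv.Ring.rdivp f mu * mu + r := Pdiv.RingMonic.rdivp_eq monmu f.
exists (c%:P ^+ k * Pdiv.Ring.rdivp f mu).
rewrite {1}fE mulrDr mulrA [X in X - _]addrC addrK => i.
rewrite -polyC_exp coefCM; apply: (torI _ _ N); rewrite -coefCM polyC_exp.
pose p := c%:P ^+ N * f - q * mu.
have -> : c%:P ^+ N * r = Pdiv.Ring.rmodp p mu.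
  rewrite /p Pdiv.RingMonic.rmodpB // Pdiv.RingMonic.rmodp_mull // subr0.
  by rewrite -polyC_exp !mul_polyC Pdiv.RingMonic.rmodpZ.
rewrite -[p]coefK poly_def Pdiv.RingMonic.rmodp_sum // coef_sum.
apply: ideal_sum => // j _ _; rewrite Pdiv.RingMonic.rmodpZ // coefZ.
by apply: ideal_mulr.
Qed.

Lemma torsion_exponent_monic (A : comNzRingType) (I : A -> Prop) k
    (mu : {poly A}) :
  ideal I -> torsion_exponent k I -> mu \is monic ->
  torsion_exponent ((size mu).-1 * (1 + (size mu).-1 * k))
    (adjoin (polyideal I) mu).
Proof.
move=> idI torI monmu a f N Jf.
have idJ : ideal (adjoin (polyideal I) mu).
  exact/adjoin_ideal/polyideal_ideal.
have [c monc [<- [w ca]]] := integral_equation_modulo_monic a monmu.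
rewrite -(size_map_polyC c).
apply: (@torsion_of_monic_value _ _ k a N) => // [i g M||].
- by rewrite coef_map /=; exact: torsion_exponent_constants.
- by rewrite monic_map.
- rewrite expr1 -[_.[a]]/(c \Po a) ca mulrC mulrA; apply: ideal_mull => //.
  exact/adjoin_mem/polyideal_ideal.
Qed.

End TorsionExponent.

(** * Bounded saturation of triangular systems *)

Section CoordinateSystems.
Local Open Scope ring_scope.

(** The differential polynomial ring enters the study of triangular systems only
    through this interface: [along v f] is [f] seen as a polynomial in the
    variable [coord v], the other variables being left among the coefficients. *)
Record coordinates (C : comNzRingType) (V : eqType) := Coordinates {
  coord : V -> C;
  along : V -> {rmorphism C -> {poly C}};
  along_horner : forall v f, (along v f).[coord v] = f;
  along_coord : forall v, along v (coord v) = 'X;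
  along_coord_neq : forall v w, w != v -> along v (coord w) = (coord w)%:P;
  along_coef : forall v f l, along v (along v f)`_l = ((along v f)`_l)%:P;
  along_comm : forall v w f k l, w != v ->
    (along w (along v f)`_l)`_k = (along v (along w f)`_k)`_l }.

End CoordinateSystems.

Section Coordinates.
Local Open Scope ring_scope.
Context {C : comNzRingType} {V : eqType} (S : coordinates C V).
Implicit Types (f g q : C) (v w x y : V) (I J : C -> Prop) (p F G : {poly C}).
Local Notation X := (coord S).

Definition const_along v f := along S v f = f%:P.
Definition deg_le v e f := (size (along S v f) <= e.+1)%N.

Lemma const_along_sum v (T : Type) (r : seq T) (P : pred T) (F : T -> C) :
  (forall i, P i -> const_along v (F i)) -> const_along v (\sum_(i <- r | P i) F i).
Proof. by move=> Fv; rewrite /const_along !rmorph_sum; apply: eq_bigr => i /Fv. Qed.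

Lemma const_alongM v f g : const_along v f -> const_along v g -> const_along v (f * g).
Proof. by rewrite /const_along rmorphM polyCM => -> ->. Qed.

Lemma const_alongX v f k : const_along v f -> const_along v (f ^+ k).
Proof. by rewrite /const_along rmorphXn polyC_exp => ->. Qed.

Lemma const_along_coord v w : w != v -> const_along v (X w).
Proof. exact: along_coord_neq. Qed.

Lemma const_along_coef v f l : const_along v (along S v f)`_l.
Proof. exact: along_coef. Qed.

Lemma const_along_coef_other v w f l : const_along w f -> const_along w (along S v f)`_l.
Proof.
have [->|wv] := eqVneq w v; first by rewrite /const_along along_coef.
rewrite /const_along => fw; apply/polyP => k; rewrite along_comm // fw !coefC.
by case: ifP; rewrite // rmorph0 coef0.
Qed.

Lemma deg_le_coef_along v w e f l : deg_le w e f -> deg_le w e (along S v f)`_l.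
Proof.
have [->|wv] := eqVneq w v.
  by rewrite /deg_le along_coef size_polyC => _; case: eqP.
move=> /leq_sizeP fe; apply/leq_sizeP => k /fe fk.
by rewrite along_comm // fk rmorph0 coef0.
Qed.

Lemma deg_leD v e f g : deg_le v e f -> deg_le v e g -> deg_le v e (f + g).
Proof.
rewrite /deg_le rmorphD => fe ge; rewrite (leq_trans (size_polyD _ _)) //.
by rewrite geq_max fe.
Qed.

Lemma deg_le_sum v e (T : Type) (r : seq T) (P : pred T) (F : T -> C) :
  (forall i, P i -> deg_le v e (F i)) -> deg_le v e (\sum_(i <- r | P i) F i).
Proof.
move=> Fe; elim/big_rec: _ => [|i f Pi fe]; last by apply: deg_leD => //; apply: Fe.
by rewrite /deg_le rmorph0 size_poly0.
Qed.

Lemma deg_leM v d e f g :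
  deg_le v d f -> deg_le v e g -> deg_le v (d + e) (f * g).
Proof.
move=> fd ge; rewrite /deg_le rmorphM (leq_trans (size_polyMleq _ _)) //.
by move: fd ge; rewrite /deg_le; lia.
Qed.

Lemma deg_le_const v f : const_along v f -> deg_le v 0 f.
Proof. by rewrite /deg_le => ->; apply: size_polyC_leq1. Qed.

Lemma deg_leMr v e f g : deg_le v e f -> const_along v g -> deg_le v e (f * g).
Proof. by move=> fe /deg_le_const ge; rewrite -[e]addn0; apply: deg_leM. Qed.

Lemma const_along_horner w x G :
  (forall l, const_along w G`_l) -> x != w -> const_along w G.[X x].
Proof.
move=> Gw xw; rewrite horner_coef; apply: const_along_sum => l _.
by apply: const_alongM => //; apply/const_alongX/const_along_coord.
Qed.

Lemma along_horner_const v G : (forall l, const_along v G`_l) -> along S v G.[X v] = G.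
Proof.
move=> Gv; rewrite horner_coef rmorph_sum -[RHS]coefK poly_def.
by apply: eq_bigr => l _; rewrite rmorphM rmorphXn /= along_coord Gv mul_polyC.
Qed.

Lemma deg_le_horner v x e G :
  (forall l, deg_le v e G`_l) -> x != v -> deg_le v e G.[X x].
Proof.
move=> Ge xv; rewrite horner_coef; apply: deg_le_sum => l _.
by apply: deg_leMr => //; apply/const_alongX/const_along_coord.
Qed.

Lemma deg_le_expand v e f :
  deg_le v e f -> f = \sum_(l < e.+1) (along S v f)`_l * X v ^+ l.
Proof. by move=> fe; rewrite -[LHS](along_horner S v) (horner_coef_wide _ fe). Qed.

(** The homogenization in degree [e], with respect to [coord v], of [f], with [q]
    as the second homogeneous variable. *)
Definition rescale v q e f :=
  \sum_(l < e.+1) (along S v f)`_l * q ^+ (e - l) * X v ^+ l.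

Definition dilate v q := horner_eval (q * X v) \o along S v.
HB.instance Definition _ v q :=
  GRing.RMorphism.copy (dilate v q) (horner_eval (q * X v) \o along S v).

Lemma dilate_const v q f : const_along v f -> dilate v q f = f.
Proof. by rewrite /dilate /= /horner_eval => ->; rewrite hornerC. Qed.

Lemma dilate_coord v q : dilate v q (X v) = q * X v.
Proof. by rewrite /dilate /= /horner_eval along_coord hornerX. Qed.

Lemma dilate_rescale v q e f : const_along v q -> deg_le v e f ->
  dilate v q (rescale v q e f) = q ^+ e * f.
Proof.
move=> qv fe; rewrite {2}(deg_le_expand fe) mulr_sumr rmorph_sum.
apply: eq_bigr => l _; rewrite !rmorphM !rmorphXn /= dilate_coord.
rewrite (dilate_const _ qv) (dilate_const _ (const_along_coef _ _ _)).
have -> : q ^+ e = q ^+ (e - l) * q ^+ l by rewrite -exprD subnK ?leq_ord.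
rewrite exprMn.
by move: (_ ^+ (e - l)) (q ^+ l) (X v ^+ l) => a b c; ring.
Qed.

Lemma rescale_horner v q e x G : x != v ->
  rescale v q e G.[X x] = (\poly_(l < size G) rescale v q e G`_l).[X x].
Proof.
move=> xv; rewrite horner_poly horner_coef /rescale rmorph_sum.
under eq_bigr => l _ do rewrite coef_sum !mulr_suml.
rewrite exchange_big; apply: eq_bigr => k _; rewrite mulr_suml.
apply: eq_bigr => l _; rewrite rmorphM rmorphXn /= (const_along_coord xv) -polyC_exp.
by rewrite coefMC -!mulrA; congr (_ * _); rewrite mulrCA; congr (_ * _); rewrite mulrC.
Qed.

Lemma rescale0 v q e : rescale v q e 0 = 0.
Proof. by rewrite /rescale big1 // => l _; rewrite rmorph0 coef0 !mul0r. Qed.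

Lemma const_along_rescale v q e y f :
  y != v -> const_along y q -> const_along y f -> const_along y (rescale v q e f).
Proof.
move=> yv qy fy; apply: const_along_sum => l _; apply: const_alongM; last first.
  by apply/const_alongX/const_along_coord; rewrite eq_sym.
by apply: const_alongM; [apply: const_along_coef_other|apply: const_alongX].
Qed.

Lemma deg_le_rescale v q e y d f :
  y != v -> const_along y q -> deg_le y d f -> deg_le y d (rescale v q e f).
Proof.
move=> yv qy fy; apply: deg_le_sum => l _; apply: deg_leMr; last first.
  by apply/const_alongX/const_along_coord; rewrite eq_sym.
by apply: deg_leMr; [apply: deg_le_coef_along|apply: const_alongX].
Qed.

(** A new variable ['X] is attached to [coord v]; it plays the part of [1 / q] in
    [mark_rescale]. *)
Definition mark v := comp_poly ((X v)%:P * 'X) \o along S v.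
HB.instance Definition _ v :=
  GRing.RMorphism.copy (mark v) (comp_poly ((X v)%:P * 'X) \o along S v).

Lemma mark_const v f : const_along v f -> mark v f = f%:P.
Proof. by rewrite /mark /= => ->; rewrite comp_polyC. Qed.

Lemma markE v e f : deg_le v e f -> mark v f =
  \sum_(l < e.+1) ((along S v f)`_l * X v ^+ l)%:P * 'X^l.
Proof.
move=> fe; rewrite /mark /= comp_polyE (big_ord_widen _ (fun l =>
   (along S v f)`_l *: ((X v)%:P * 'X) ^+ l) fe) big_mkcond.
apply: eq_bigr => l _; case: ltnP => [_|/leq_sizeP ->//]; last first.
  by rewrite mul0r mul0r.
by rewrite -mul_polyC exprMn -polyC_exp mulrA -polyCM.
Qed.

Lemma mark_rescale v q e f (Q : {poly C} -> Prop) :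
  ideal Q -> Q (1 - q%:P * 'X) -> deg_le v e f ->
  Q (mark v f - 'X^e * (rescale v q e f)%:P).
Proof.
move=> idQ Qq fe; rewrite (markE fe) rmorph_sum mulr_sumr -sumrB.
apply: ideal_sum => // l _ _.
have -> : ((along S v f)`_l * X v ^+ l)%:P * 'X^l -
    'X^e * ((along S v f)`_l * q ^+ (e - l) * X v ^+ l)%:P =
    ((along S v f)`_l * X v ^+ l)%:P * 'X^l *
      (1 ^+ (e - l) - (q%:P * 'X) ^+ (e - l)).
  rewrite expr1n mulrBr mulr1; congr (_ - _).
  have -> : 'X^e = 'X^(e - l) * 'X^l :> {poly C}.
    by rewrite -exprD subnK ?leq_ord.
  rewrite exprMn !(polyCM, polyC_exp).
  move: ((along S v f)`_l)%:P 'X (X v)%:P q%:P => a b c d.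
  move: (e - l)%N (nat_of_ord l) => i j.
  by ring.
by apply: ideal_mull => //; apply: ideal_congX.
Qed.


Definition stable v I := forall f, I f -> polyideal I (along S v f).

(** Stability of [I] allows the relation to be read coefficient by coefficient
    in [coord v], which is [linear_elimination]. *)
Lemma eliminate_linear v I g a b (p : C) : ideal I -> stable v I ->
  const_along v g -> const_along v a -> const_along v b -> I (g - p * (a * X v + b)) ->
  exists k, I (a ^+ k * g).
Proof.
move=> idI stI gv av bv /stI.
rewrite rmorphB rmorphM rmorphD rmorphM along_coord gv av bv.
exact: linear_elimination.
Qed.

Lemma stable_ideal_gen v (G : C -> Prop) :
  (forall h, G h -> const_along v h) -> stable v (ideal_gen G).
Proof.
move=> Gv _ [s [sG ->]] l; rewrite rmorph_sum coef_sum.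
apply: ideal_sum => [|p ps _]; first exact: ideal_gen_ideal.
rewrite rmorphM (Gv _ (sG p ps)) coefMC.
by apply: ideal_mull; [apply: ideal_gen_ideal|apply/ideal_gen_mem/sG].
Qed.

Lemma stable_zero v : stable v (eq^~ 0).
Proof. by move=> _ -> l; rewrite rmorph0 coef0. Qed.

Lemma stable_adjoin v I a : stable v I -> const_along v a -> stable v (adjoin I a).
Proof.
move=> stI av f [h /stI If] l; exists (along S v h)`_l.
by have := If l; rewrite rmorphB rmorphM /= av coefB coefMC.
Qed.

Lemma torsion_exponent_adjoin v I k F : ideal I -> stable v I ->
  torsion_exponent k I -> F \is monic -> (forall l, const_along v F`_l) ->
  torsion_exponent ((size F).-1 * (1 + (size F).-1 * k)) (adjoin I F.[X v]).
Proof.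
move=> idI stI torI monF Fv a f N.
have adjE h : adjoin I F.[X v] h <-> adjoin (polyideal I) F (along S v h).
  split=> [[w /stI Iw]|[w Iw]].
    by exists (along S v w); rewrite -(along_horner_const Fv) -rmorphM -rmorphB.
  exists w.[X v]; rewrite -[h](along_horner S v) -hornerM -hornerN -hornerD.
  exact: polyideal_horner.
rewrite !adjE !rmorphM !rmorphXn /=; exact: torsion_exponent_monic.
Qed.

(** A step of a triangular system is a variable [v], a formal degree [D] and a
    polynomial of degree at most [D] that is to be evaluated at [v].  The
    coefficient of degree [D] may vanish, so that rescaling the coefficients
    always gives a step of the same shape. *)
Definition step := (V * nat * {poly C})%type.
Implicit Types (t u : step) (s : seq step).

Definition step_var t := t.1.1.
Definition step_deg t := t.1.2.
Definition step_poly t := t.2.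
Definition step_value t := (step_poly t).[X (step_var t)].
Definition step_initial t := (step_poly t)`_(step_deg t).

(** The list starts from the lowest variable: the polynomial of a step does not
    involve the variables of the later steps, whereas the degrees of the later
    steps in its variable are bounded by [e]. *)
Fixpoint triangular e s : Prop :=
  if s is t :: s' then
    [/\ (0 < step_deg t)%N, (size (step_poly t) <= (step_deg t).+1)%N,
        (forall l, const_along (step_var t) (step_poly t)`_l),
        {in s', forall u, [/\ step_var u != step_var t,
           forall l, const_along (step_var u) (step_poly t)`_l &
           forall l, deg_le (step_var t) e (step_poly u)`_l]} &
        triangular e s']
  else True.

Fixpoint sysideal I s : C -> Prop :=
  if s is t :: s' then sysideal (adjoin I (step_value t)) s' else I.

Lemma sysideal_ideal I s : ideal I -> ideal (sysideal I s).
Proof. by elim: s I => //= t s IHs I idI; apply/IHs/adjoin_ideal. Qed.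

Lemma sysideal_sub I s f : I f -> sysideal I s f.
Proof. by elim: s I => //= t s IHs I If; apply/IHs/adjoin_sub. Qed.

Lemma sysideal_mem I s t : ideal I -> t \in s -> sysideal I s (step_value t).
Proof.
elim: s I => //= u s IHs I idI; rewrite inE => /predU1P[->|ts].
  exact/sysideal_sub/adjoin_mem.
by apply: IHs => //; apply: adjoin_ideal.
Qed.

Lemma sysideal_least I J s : ideal J -> (forall f, I f -> J f) ->
  {in s, forall t, J (step_value t)} -> forall f, sysideal I s f -> J f.
Proof.
elim: s I => //= t s IHs I idJ IJ sJ; apply: IHs => //.
  by apply: adjoin_least => //; apply: sJ; rewrite mem_head.
by move=> u us; apply: sJ; rewrite inE us orbT.
Qed.

Lemma preimage_ideal (B : comNzRingType) (phi : {rmorphism C -> B})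
  (J : B -> Prop) : ideal J -> ideal (fun f => J (phi f)).
Proof.
move=> idJ; split=> [|x y Jx Jy|a x Jx].
- by rewrite rmorph0; apply: ideal_0.
- by rewrite rmorphD; apply: ideal_add.
- by rewrite rmorphM; apply: ideal_mull.
Qed.

Section MakeMonic.
Variables (I : C -> Prop) (e : nat) (t : step) (s : seq step).
Hypotheses (idI : ideal I) (stI : stable (step_var t) I).
Hypothesis tri : triangular e (t :: s).
Local Notation v := (step_var t).
Local Notation D := (step_deg t).
Local Notation F := (step_poly t).
Local Notation q := (step_initial t).

(** The polynomial [q ^+ D.-1 * F] becomes this one when [q * coord v] is taken
    as the new variable, see [dilate_monic_value]. *)
Definition monic_poly : {poly C} :=
  'X^D + \poly_(l < D) (F`_l * q ^+ (D - l.+1)).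

Definition rescale_step u : step :=
  (step_var u, step_deg u,
   \poly_(l < size (step_poly u)) rescale v q e (step_poly u)`_l).

Definition rescale_steps := map rescale_step s.

Lemma initial_const : const_along v q.
Proof. by case: tri => _ _ Fv _ _; apply: Fv. Qed.

Lemma size_monic_tail :
  (size (\poly_(l < D) (F`_l * q ^+ (D - l.+1)))%R < size ('X^D : {poly C})%R)%N.
Proof. by rewrite size_polyXn ltnS size_poly. Qed.

Lemma monic_poly_monic : monic_poly \is monic.
Proof. by rewrite monicE lead_coefDl ?size_monic_tail // lead_coefXn. Qed.

Lemma size_monic_poly : size monic_poly = D.+1.
Proof. by rewrite size_polyDl ?size_monic_tail // size_polyXn. Qed.

Lemma const_along_monic_poly w :
  (forall l, const_along w F`_l) -> forall l, const_along w monic_poly`_l.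
Proof.
move=> Fw l; rewrite /const_along coefD coefXn coef_poly rmorphD polyCD.
congr (_ + _); first by rewrite rmorph_nat polyC_natr.
case: ifP => _; last by rewrite rmorph0.
by apply: const_alongM => //; apply/const_alongX/Fw.
Qed.

Lemma monic_value : monic_poly.[X v] =
  X v ^+ D + \sum_(l < D) F`_l * q ^+ (D - l.+1) * X v ^+ l.
Proof. by rewrite hornerD hornerXn horner_poly. Qed.

Lemma step_valueE : step_value t = q * X v ^+ D + \sum_(l < D) F`_l * X v ^+ l.
Proof.
case: tri => _ szF _ _ _; rewrite /step_value (horner_coef_wide _ szF).
by rewrite big_ord_recr addrC.
Qed.

Lemma rescale_step_value : rescale v q D (step_value t) = q * monic_poly.[X v].
Proof.
case: tri => _ _ Fv _ _; rewrite monic_value /rescale /step_value.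
rewrite along_horner_const // big_ord_recr /= subnn mulr1 addrC mulrDr.
congr (_ + _); rewrite mulr_sumr; apply: eq_bigr => l _.
have -> : q ^+ (D - l) = q ^+ (D - l.+1) * q.
  by rewrite -exprSr subnSK.
by move: (q ^+ _) (X v ^+ l) => a b; ring.
Qed.

Lemma dilate_monic_value :
  dilate v q monic_poly.[X v] = q ^+ D.-1 * step_value t.
Proof.
case: tri => D_gt0 _ Fv _ _; rewrite monic_value step_valueE rmorphD rmorph_sum.
rewrite rmorphXn /= dilate_coord mulrDr exprMn mulrA -exprSr prednK //.
congr (_ + _); rewrite mulr_sumr; apply: eq_bigr => l _.
rewrite !rmorphM !rmorphXn /= dilate_coord !dilate_const //; last exact: initial_const.
have -> : q ^+ D.-1 = q ^+ (D - l.+1) * q ^+ l.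
  by rewrite -exprD; congr (_ ^+ _); have := ltn_ord l; lia.
by rewrite exprMn; move: (q ^+ _) (q ^+ l) (X v ^+ l) => a b c; ring.
Qed.

Lemma rescale_stepE u : u \in s ->
  step_value (rescale_step u) = rescale v q e (step_value u).
Proof.
move=> us; case: tri => _ _ _ /(_ u us)[uv _ _] _.
by rewrite /step_value [RHS]rescale_horner.
Qed.


Lemma coef_rescale_step u l :
  (step_poly (rescale_step u))`_l = rescale v q e (step_poly u)`_l.
Proof.
rewrite coef_poly; case: ltnP => // le_l.
by rewrite nth_default // rescale0.
Qed.

Lemma rescale_steps_triangular : triangular e rescale_steps.
Proof.
case: tri => _ _ _ sP; rewrite /rescale_steps.
have {sP}: forall u, u \in s ->
  [/\ step_var u != v, const_along (step_var u) q &
      forall l, deg_le v e (step_poly u)`_l].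
  by move=> u /sP[uv uF ue]; split=> //; apply: uF.
elim: (s) => //= u s' IHs' sP [D_gt0 szu uu us' tris'].
have [uv uq _] := sP u (mem_head _ _).
have {}sP (w : step) : w \in s' -> [/\ step_var w != v, const_along (step_var w) q &
      forall l, deg_le v e (step_poly w)`_l].
  by move=> ws'; apply: sP; rewrite inE ws' orbT.
split=> //=.
- exact: leq_trans (size_poly _ _) szu.
- by move=> l; rewrite coef_rescale_step; apply: const_along_rescale.
- move=> _ /mapP[w ws' ->]; have [wu wfree udeg] := us' w ws'.
  have [wv wq _] := sP w ws'.
  split=> // l; rewrite coef_rescale_step; first exact: const_along_rescale.
  exact: deg_le_rescale.
- exact: IHs'.
Qed.

Lemma step_value_deg_le u : u \in s -> deg_le v e (step_value u).
Proof.
move=> us; case: tri => _ _ _ /(_ u us)[uv _ ue] _.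
exact: deg_le_horner.
Qed.

Local Notation K := (sysideal (adjoin I (step_value t)) s).
Local Notation K' := (sysideal (adjoin I monic_poly.[X v]) rescale_steps).

Lemma sysideal_rescaled f : K' f -> K (dilate v q f).
Proof.
have idK : ideal K by apply/sysideal_ideal/adjoin_ideal.
apply: (sysideal_least (J := fun f => K (dilate v q f))).
- exact: preimage_ideal.
- apply: adjoin_least; first exact: preimage_ideal.
    move=> h Ih; apply/sysideal_sub/adjoin_sub.
    rewrite /dilate /= /horner_eval; apply: polyideal_horner => //; exact: stI.
  rewrite dilate_monic_value; apply: ideal_mull => //.
  exact/sysideal_sub/adjoin_mem.
- move=> _ /mapP[u us ->]; rewrite rescale_stepE // dilate_rescale.
  + by apply: ideal_mull => //; apply: sysideal_mem => //; apply: adjoin_ideal.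
  + exact: initial_const.
  + exact: step_value_deg_le.
Qed.

Lemma step_initial_rescale u :
  step_initial (rescale_step u) = rescale v q e (step_initial u).
Proof. exact: coef_rescale_step. Qed.

Lemma step_initial_deg_le u : u \in s -> deg_le v e (step_initial u).
Proof. by move=> us; case: tri => _ _ _ /(_ u us)[_ _ ue] _; apply: ue. Qed.

(** Inverting [q] would turn [coord v] into [coord v / q] and make the two
    systems equivalent.  Instead of fractions, the relation is written with a
    variable ['X] subject to [1 - q * 'X], modulo which [mark v f] is
    ['X ^+ e * rescale v q e f]; the elimination of ['X] then costs a power of
    [q]. *)
Lemma sysideal_rescale d d' a g N :
  deg_le v d' a -> deg_le v d g ->
  K ((a * \prod_(u <- t :: s) step_initial u) ^+ N * g) ->
  exists N', K' ((q * rescale v q d' a *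
                  \prod_(u <- rescale_steps) step_initial u) ^+ N' *
                 rescale v q d g).
Proof.
move=> ad gd KN; have idI' : ideal (adjoin I monic_poly.[X v]).
  exact: adjoin_ideal.
have idK' : ideal K' by apply: sysideal_ideal.
pose Q := adjoin (polyideal K') (1 - q%:P * 'X).
have idQ : ideal Q by apply: adjoin_ideal; apply: polyideal_ideal.
have Qq : Q (1 - q%:P * 'X) by apply: adjoin_mem; apply: polyideal_ideal.
have Qmark i f : deg_le v i f -> Q (mark v f - 'X^i * (rescale v q i f)%:P).
  exact: mark_rescale.
have Qconst f : K' f -> Q f%:P by move=> Kf; apply: adjoin_sub; apply: polyidealC.
have Qval i f : deg_le v i f -> K' (rescale v q i f) -> Q (mark v f).
  move=> /Qmark Qf /Qconst Kf.
  rewrite -(subrK ('X^i * (rescale v q i f)%:P) (mark v f)).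
  by apply: ideal_add => //; apply: ideal_mull.
have KQ f : K f -> Q (mark v f).
  apply: (sysideal_least (J := fun f => Q (mark v f))).
  - exact: preimage_ideal.
  - apply: adjoin_least; first exact: preimage_ideal.
      move=> h Ih; apply/adjoin_sub; rewrite (markE (leqnSn _)) => k.
      rewrite coef_sum; apply: ideal_sum => // l _ _.
      rewrite coefCM; apply: ideal_mulr => //; apply: ideal_mulr => //.
      exact/sysideal_sub/adjoin_sub/stI.
    apply: (Qval D).
      case: tri => _ szF Fv _ _; rewrite /deg_le along_horner_const //.
    rewrite rescale_step_value; apply: ideal_mull => //.
    exact/sysideal_sub/adjoin_mem.
  - move=> u us; apply: (Qval e); first exact: step_value_deg_le.
    rewrite -rescale_stepE //; apply: sysideal_mem => //; exact: map_f.
pose R f f' := exists i, Q (mark v f - 'X^i * f'%:P).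
have RM f f' h h' : R f f' -> R h h' -> R (f * h) (f' * h').
  move=> [i Qf] [j Qh]; exists (i + j)%N.
  by rewrite rmorphM exprD polyCM mulrACA; apply: ideal_congM.
have Rq : R q q.
  exists 0%N; rewrite mul1r mark_const ?subrr; last exact: initial_const.
  exact: ideal_0.
have Rprod s' : {subset s' <= s} -> R (\prod_(u <- s') step_initial u)
    (\prod_(u <- map rescale_step s') step_initial u).
  elim: s' => [|u s' IHs'] ss'.
    by exists 0%N; rewrite !big_nil rmorph1 !mulr1 subrr; apply: ideal_0.
  rewrite /= !big_cons; apply: RM; last first.
    by apply: IHs' => w ws'; apply: ss'; rewrite inE ws' orbT.
  have us := ss' u (mem_head _ _); exists e; rewrite step_initial_rescale.
  exact/Qmark/step_initial_deg_le.
have Rexp f f' k : R f f' -> R (f ^+ k) (f' ^+ k).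
  move=> Rf; elim: k => [|k IHk]; last by rewrite !exprS; apply: RM.
  by exists 0%N; rewrite rmorph1 !mulr1 subrr; apply: ideal_0.
set b := q * _ * _.
have [i Qi] : R ((a * \prod_(u <- t :: s) step_initial u) ^+ N * g)
              (b ^+ N * rescale v q d g).
  apply: (RM); last by exists d; apply: Qmark.
  apply: Rexp; rewrite big_cons mulrCA mulrA.
  apply: (RM); last exact: Rprod.
  by apply: (RM) => //; exists d'; apply: Qmark.
have {Qi} Qi : Q ('X^i * (b ^+ N * rescale v q d g)%:P).
  have := ideal_sub idQ (KQ _ KN) Qi; rewrite opprB addrC subrK; exact.
(* Since [q * 'X] is 1 modulo [Q], the power of ['X] can be cancelled. *)
have {Qi} [r] : Q (b ^+ N * rescale v q d g)%:P.
  set h := (b ^+ N * _) in Qi *.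
  rewrite -(subrK ((q%:P * 'X) ^+ i * h%:P) h%:P); apply: ideal_add => //.
    rewrite -{1}[h%:P]mul1r -mulrBl -{1}(expr1n _ i); apply: ideal_mulr => //.
    exact: ideal_congX.
  by rewrite exprMn -mulrA; apply: ideal_mull.
have -> : 1 - q%:P * 'X = (- q)%:P * 'X + 1%:P :> {poly C}.
  by rewrite polyCN mulNr addrC.
case/(linear_elimination idK') => k; rewrite exprNn -mulrA => Kk.
exists (k + N)%N; rewrite exprD -mulrA /b -[q * _ * _]mulrA exprMn.
rewrite mulrAC; apply: ideal_mulr => //.
have := ideal_mull idK' ((-1) ^+ k) Kk.
by rewrite signrMK /b -[q * _ * _]mulrA.
Qed.

End MakeMonic.

(** The list [ds] contains the degrees of the steps and [k] is the torsion
    exponent of the ideal that they extend; [e], [e'] and [d] bound the degrees,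
    in the variables of the system, of the steps, of the cofactor [a] and of the
    element [g] in [triangular_saturation]. *)
Fixpoint saturation_exponent e e' d k (ds : seq nat) : nat :=
  if ds is D :: ds' then
    (1 + e' + e * size ds') * saturation_exponent e e' d (D * (1 + D * k)) ds' + d
  else k.

(** The first step is made monic and moved into the base ideal.  The new
    cofactor contains its initial [q], which keeps [q] a divisor of the element
    whose powers are considered; [dilate] brings the conclusion back, where each
    homogenization in degree [i] contributes a factor [q ^+ i]. *)
Theorem triangular_saturation I e e' d k s a g N :
  ideal I -> {in s, forall t, stable (step_var t) I} -> torsion_exponent k I ->
  triangular e s ->
  {in s, forall t, deg_le (step_var t) e' a} ->
  {in s, forall t, deg_le (step_var t) d g} ->
  let h := a * \prod_(t <- s) step_initial t in
  sysideal I s (h ^+ N * g) ->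
  sysideal I s (h ^+ saturation_exponent e e' d k (map step_deg s) * g).
Proof.
move: {2}(size s) (erefl (size s)) => r.
elim: r s I k a g N => [|r IHr] [|t s] // I k a g N szs idI stI torI tri ad gd h Kg.
  exact: torI Kg.
have ts u : u \in s -> u \in t :: s by rewrite inE orbC => ->.
have tP := mem_head t s; have stIt := stI t tP.
case: (tri) => D_gt0 szt tfree later tris.
set v := step_var t in stIt later *; pose q := step_initial t.
pose D := step_deg t; pose I' := adjoin I (monic_poly t).[X v].
have idI' : ideal I' by apply: adjoin_ideal.
have laterP u : u \in s -> step_var u != v /\ const_along (step_var u) q.
  by move=> /later[uv uF _]; split=> //; apply: uF.
have stI' : {in rescale_steps e t s, forall u, stable (step_var u) I'}.
  move=> _ /mapP[u us ->]; have [uv uF _] := later u us.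
  apply: stable_adjoin; first exact: (stI u (ts u us)).
  by apply: const_along_horner; [apply: const_along_monic_poly|rewrite eq_sym].
have torI' : torsion_exponent (D * (1 + D * k)) I'.
  have := torsion_exponent_adjoin idI stIt torI (monic_poly_monic t).
  rewrite size_monic_poly; by apply; apply: const_along_monic_poly.
have [N' K'g] := sysideal_rescale idI stIt tri (ad t tP) (gd t tP) Kg.
set b := q * _ in K'g; set g' := rescale v q d g in K'g.
have b_deg : {in rescale_steps e t s, forall u, deg_le (step_var u) e' b}.
  move=> _ /mapP[u us ->]; have [uv uq] := laterP u us.
  rewrite /b mulrC; apply: deg_leMr => //.
  by apply: deg_le_rescale => //; exact: (ad u (ts u us)).
have g'_deg : {in rescale_steps e t s, forall u, deg_le (step_var u) d g'}.
  move=> _ /mapP[u us ->]; have [uv uq] := laterP u us.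
  by apply: deg_le_rescale => //; exact: (gd u (ts u us)).
have sz' : size (rescale_steps e t s) = r by rewrite size_map; case: szs.
have := IHr _ _ _ _ _ _ sz' idI' stI' torI' (rescale_steps_triangular tri)
  b_deg g'_deg K'g.
have -> : map step_deg (rescale_steps e t s) = map step_deg s.
  by rewrite -map_comp; apply: eq_map.
set M := saturation_exponent _ _ _ _ _.
move=> /(sysideal_rescaled idI stIt tri); rewrite -/v -/q rmorphM rmorphXn rmorphM /=.
have qv : const_along v q by apply: tfree.
have prodE : dilate v q (\prod_(u <- rescale_steps e t s) step_initial u) =
    q ^+ (e * size s) * \prod_(u <- s) step_initial u.
  have : {in s, forall u, deg_le v e (step_initial u)}.
    by move=> u us; have [_ _ ue] := later u us; apply: ue.
  rewrite /rescale_steps; elim: (s) => [|u s' IHs'] s'e.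
    by rewrite !big_nil rmorph1 muln0 mulr1.
  rewrite /= !big_cons rmorphM /= step_initial_rescale IHs'; last first.
    by move=> w ws'; apply: s'e; rewrite inE ws' orbT.
  rewrite dilate_rescale //; last by apply: s'e; rewrite mem_head.
  by rewrite mulrACA -exprD mulnS.
rewrite prodE /b rmorphM /= (dilate_const _ qv) !dilate_rescale //; last 2 first.
- exact: gd.
- exact: ad.
set P := \prod_(u <- s) _; have idK := sysideal_ideal s (adjoin_ideal (step_value t) idI).
move=> Kqg; rewrite /= size_map exprD -mulrA exprM -/M.
have hE : h = a * P * q by rewrite /h big_cons -/q -/P mulrCA mulrC.
set E := (1 + e' + e * size s)%N.
have -> : h ^+ E = (a * P) ^+ (e' + e * size s) *
    (q * (q ^+ e' * a) * (q ^+ (e * size s) * P)).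
  rewrite hE /E -addnA add1n.
  by rewrite exprMn !exprS !exprD; ring.
rewrite (exprMn M) hE (exprMn d).
set x := (_ * _) ^+ M in Kqg *; set y := (_ ^+ _) ^+ M.
rewrite -(mulrA y) -(mulrA ((a * P) ^+ d)) [x * _]mulrCA.
by do 2!apply: ideal_mull => //.
Qed.

End Coordinates.

(** * Differential polynomials as polynomials in one derivative *)

Section Univariate.
Local Open Scope fset_scope.
Local Open Scope ring_scope.
Context {K : fieldType} {m n : nat}.
Implicit Types (f g : dpoly K m n) (v w : derivative m n) (u : dmonom m n)
  (P : pred (derivative m n)).

(** The monomial used by [coefv]. *)
Definition strip v u : dmonom m n := [cmonom u w | w in finsupp u `\ v]%M.

Lemma stripE v u w : strip v u w = if w == v then 0%N else u w.
Proof.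
rewrite cmE fsfun_fun in_fsetD1; case: eqVneq => //= _.
by case: finsuppP.
Qed.

Lemma strip_comm v w u : strip v (strip w u) = strip w (strip v u).
Proof.
have E y z x : strip y (strip z u) x = if (x == y) || (x == z) then 0%N else u x.
  apply: etrans (stripE y _ x) _.
  by case: (x == y) => /=; last exact: stripE.
apply/eqP/cmP => x; apply: etrans (E v w x) _; apply: esym.
by apply: etrans (E w v x) _; rewrite orbC.
Qed.

Lemma malgUM (c d : K) u1 u2 :
  << c *g u1 >> * << d *g u2 >> = << c * d *g mmul u1 u2 >> :> dpoly K m n.
Proof. by rewrite malgM_def fgmulUU. Qed.

Lemma malgU_scale (c : K) u : << c *g u >> = c%:MP * << u >> :> dpoly K m n.
Proof. by rewrite malgUM mulr1 mul1m. Qed.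

Lemma dvar_expr v e :
  exists2 u, dvar v ^+ e = << u >> :> dpoly K m n &
             forall w, u w = if w == v then e else 0%N.
Proof.
elim: e => [|e [u IHe uE]].
  by exists mone => // w; rewrite cm1 if_same.
exists (mmul (ucm v) u) => [|w].
  rewrite [LHS]exprS IHe /dvar malgUM mulr1.
  reflexivity.
by rewrite cmM cmU uE eq_sym; case: eqP.
Qed.

Definition mono_in v u : {poly dpoly K m n} := << strip v u >>%:P * 'X^(u v).

Lemma mono_in_morphism v : mmorphism (mono_in v).
Proof.
split=> [u1 u2|]; rewrite /mono_in.
  rewrite cmM -polyCX_mul; congr (_%:P * _); rewrite malgUM mulr1.
  congr << _ >>.
  by apply/eqP/cmP => w; rewrite !(stripE, cmM); case: eqP.
rewrite cm1 expr0.
rewrite (_ : strip v mone = mone).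
  rewrite [LHS]mulr1.
  exact: polyC1.
by apply/eqP/cmP => w; rewrite stripE cm1 if_same.
Qed.

HB.instance Definition _ v :=
  isMultiplicative.Build _ _ (mono_in v) (mono_in_morphism v).

Definition poly_in v : dpoly K m n -> {poly dpoly K m n} :=
  mmap (polyC \o malgC) (mono_in v).

HB.instance Definition _ v := GRing.RMorphism.copy (poly_in v)
  (mmap (polyC \o malgC) (mono_in v)).

Lemma poly_inE v f : poly_in v f =
  \sum_(u <- msupp f) << f@_u *g strip v u >>%:P * 'X^(u v).
Proof.
rewrite /poly_in mmapE; apply: eq_bigr => u _.
by rewrite [LHS]polyC_mulA [in RHS]malgU_scale.
Qed.

Lemma coef_poly_in v f e : (poly_in v f)`_e = coefv v e f.
Proof.
rewrite poly_inE coef_sum /coefv [RHS]big_mkcond; apply: eq_bigr => u _.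
by rewrite coefCM coefXn eq_sym; case: eqP; rewrite (mulr1, mulr0).
Qed.

Lemma horner_poly_in v f : (poly_in v f).[dvar v] = f.
Proof.
rewrite poly_inE horner_sum [RHS]monalgE; apply: eq_bigr => u _.
rewrite [LHS]horner_CXn; have [p -> pE] := dvar_expr v (u v).
rewrite [LHS]malgUM.
rewrite mulr1.
apply: (congr1 (fun k => << f@_u *g k >>)).
apply/eqP/cmP => w.
by rewrite cmM stripE pE; case: eqP => [->|]; rewrite ?add0n ?addn0.
Qed.

Lemma varsP v f : reflect (exists2 u, u \in msupp f & u v != 0%N) (v \in vars f).
Proof.
rewrite /vars; apply: (iffP (bigfcupP _ _ _ _)) => [[u /andP[uf _] vu]|[u uf vu]]; exists u => //.
- by rewrite cmE_neq0.
- by rewrite uf.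
- by rewrite -cmE_neq0.
Qed.

Definition vars_in_pred P : pred (dpoly K m n) := fun f => all P (vars f).
Definition vars_in P := [qualify a f | vars_in_pred P f].

Lemma vars_inP P f :
  reflect (forall u, u \in msupp f -> forall w, u w != 0%N -> P w)
          (f \is a vars_in P).
Proof.
apply: (iffP allP) => Pf => [u uf w uw|w /varsP[u uf uw]].
  by apply: Pf; apply/varsP; exists u.
exact: Pf uw.
Qed.

Lemma vars_in_subring P : subring_closed (vars_in P).
Proof.
split=> [|f g|f g].
- apply/vars_inP => u /(fsubsetP msuppU_le); rewrite in_fset1 => /eqP-> w.
  by rewrite cm1.
- move=> /vars_inP Pf /vars_inP Pg; apply/vars_inP => u /(fsubsetP (msuppB_le _ _)).
  by rewrite in_fsetU => /orP[/Pf|/Pg].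
- move=> /vars_inP Pf /vars_inP Pg; apply/vars_inP => u.
  move=> /(fsubsetP (msuppM_incl _ _)) /imfset2P[u1 u1f [u2 u2g ->]] w.
  by rewrite cmM addn_eq0 negb_and => /orP[/(Pf _ u1f)|/(Pg _ u2g)].
Qed.

HB.instance Definition _ P :=
  GRing.isSubringClosed.Build _ (vars_in_pred P) (vars_in_subring P).

Lemma vars_in_monomial P (c : K) u :
  (forall w, u w != 0%N -> P w) -> << c *g u >> \is a vars_in P.
Proof.
by move=> Pu; apply/vars_inP => u' /(fsubsetP msuppU_le); rewrite inE => /eqP->.
Qed.

Lemma vars_in_dvar P v : P v -> dvar v \is a vars_in P.
Proof. by move=> Pv; apply: vars_in_monomial => w; rewrite cmU; case: (v =P w) => [<-|]. Qed.

Lemma vars_in_sub P P' f :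
  {subset P <= P'} -> f \is a vars_in P -> f \is a vars_in P'.
Proof. by move=> sP /vars_inP Pf; apply/vars_inP => u uf w /(Pf u uf) /sP. Qed.

Lemma msupp_coefv v e f u : u \in msupp (coefv v e f) ->
  exists u', [/\ u' \in msupp f, u' v = e & u = strip v u'].
Proof.
rewrite /coefv -big_filter big_seq.
have: {in [seq u <- msupp f | (u : dmonom m n) v == e],
        forall u, u \in msupp f /\ u v = e}.
  by move=> u'; rewrite mem_filter => /andP[/eqP].
move: [seq u <- msupp f | (u : dmonom m n) v == e] => s sf; rewrite -big_seq.
elim: s sf => [|u' s IHs] sf; first by rewrite big_nil msupp0.
rewrite big_cons => /(fsubsetP (msuppD_le _ _)); rewrite in_fsetU => /orP[].
  have [u'f u've] := sf u' (mem_head _ _).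
  by move=> /(fsubsetP msuppU_le); rewrite inE => /eqP ->; exists u'.
by apply: IHs => u'' u''s; apply: sf; rewrite inE u''s orbT.
Qed.

Lemma coefv_vars_in P v e f :
  f \is a vars_in P -> coefv v e f \is a vars_in [pred w | (w != v) && P w].
Proof.
move=> /vars_inP Pf; apply/vars_inP => _ /msupp_coefv[u [uf _ ->]] w.
rewrite stripE inE /=; case: (w =P v) => //= _; exact: (Pf u uf).
Qed.

Definition free_of v := vars_in (predC1 v).

Lemma coefv_free v e f : coefv v e f \is a free_of v.
Proof.
have : f \is a vars_in predT by apply/vars_inP.
by move=> /(coefv_vars_in v e); apply: vars_in_sub => w /andP[].
Qed.

Lemma poly_in_free v f : f \is a free_of v -> poly_in v f = f%:P.
Proof.
move=> /vars_inP ff; rewrite poly_inE [in RHS](monalgE f) rmorph_sum.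
rewrite big_seq [RHS]big_seq; apply: eq_bigr => u uf.
have uv : u v = 0%N.
  by apply/eqP/negPn/negP => /(ff u uf); rewrite /= eqxx.
rewrite uv expr0 [LHS]mulr1.
apply: (congr1 (fun k => << f@_u *g k >>%:P)); apply/eqP/cmP => w.
by rewrite stripE; case: eqP => // ->.
Qed.

Lemma poly_in_dvar v : poly_in v (dvar v) = 'X.
Proof.
rewrite /poly_in /dvar mmapU /= mul1r /mono_in cmU eqxx expr1.
rewrite (_ : strip v _ = mone); first exact: mul1r.
apply/eqP/cmP => w.
by rewrite stripE cm1 cmU eq_sym; case: eqP.
Qed.

Definition degv_le v e f := forall u, u \in msupp f -> (u v <= e)%N.

Lemma degv_leP v f : degv_le v (degv v f) f.
Proof.
by move=> u uf; rewrite /degv (big_fsetD1 u) //= leq_maxl.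
Qed.

Lemma size_poly_in v e f : degv_le v e f -> (size (poly_in v f) <= e.+1)%N.
Proof.
move=> fe; apply/leq_sizeP => j lt_ej; rewrite coef_poly_in /coefv big_seq_cond.
rewrite big1 // => u /andP[/fe ue /eqP uj].
by rewrite uj leqNgt lt_ej in ue.
Qed.

(** Zero divisors are excluded one variable at a time: the leading
    coefficients of [f] and [g] as polynomials in [v] involve fewer
    variables. *)
Lemma dpoly_mulf_eq0 f g : f * g = 0 -> f = 0 \/ g = 0.
Proof.
pose inV (V : {fset derivative m n}) := vars_in [pred w | w \in V].
have vV V : f \is a inV V /\ g \is a inV V -> f * g = 0 -> f = 0 \/ g = 0.
  move: {2}#|`V| (erefl #|`V|) => N; elim: N V f g => [|N IHN] V f' g' VN [fV gV].
    have cst h : h \is a inV V -> h = (h@_mone)%:MP.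
      move=> /vars_inP hV; apply/malgP => u; rewrite mcoeffC eq_sym.
      have [<-|u1] := eqVneq; first by [].
      rewrite mcoeff_outdom //; apply: contra u1 => uh.
      apply/cmP => w; rewrite cm1; apply/eqP/negPn/negP ; rewrite eq_sym => uw; have := hV u uh w uw.
      by rewrite /= (cardfs0_eq VN) in_fset0.
    rewrite (cst f') // (cst g') // malgUM => /eqP.
    rewrite monalgU_eq0 mulf_eq0 => /orP[]/eqP->; rewrite monalgU0; by [left|right].
  have /fset0Pn[v vV] : V != fset0 by rewrite -cardfs_eq0 VN.
  move=> fg0; have coefV h e : h \is a inV V -> coefv v e h \is a inV (V `\ v).
    by move=> /(coefv_vars_in v e); apply: vars_in_sub => w; rewrite !inE.
  have poly0 h : poly_in v h = 0 -> h = 0.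
    by move=> h0; rewrite -(horner_poly_in v h) h0 horner0.
  have [f0|f0] := eqVneq (poly_in v f') 0; first by left; apply: poly0.
  have [g0|g0] := eqVneq (poly_in v g') 0; first by right; apply: poly0.
  have lead0 : lead_coef (poly_in v f') * lead_coef (poly_in v g') = 0.
    rewrite mul_lead_coef -rmorphM fg0 rmorph0.
    exact: coef0.
  have V'N : #|` V `\ v| = N.
    by have := cardfsD1 v V; rewrite vV VN => -[->].
  have leadV h : h \is a inV V -> lead_coef (poly_in v h) \is a inV (V `\ v).
    by move=> hV; rewrite lead_coefE coef_poly_in; apply: coefV.
  have [/eqP|/eqP] := IHN _ _ _ V'N (conj (leadV _ fV) (leadV _ gV)) lead0.
    by rewrite lead_coef_eq0 (negPf f0).
  by rewrite lead_coef_eq0 (negPf g0).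
apply: (vV (vars f `|` vars g)).
by split; apply/allP => w wf; rewrite inE in_fsetU wf ?orbT.
Qed.

Lemma torsion_exponent_zero : torsion_exponent 1 (eq^~ (0 : dpoly K m n)).
Proof.
move=> a f [|N]; first by rewrite mul1r => ->; rewrite mulr0.
move=> /dpoly_mulf_eq0[/eqP aN|->]; last by rewrite mulr0.
suff -> : a = 0 by rewrite mul0r.
elim: N aN => [|N IHN]; first by rewrite expr1 => /eqP.
by rewrite exprS => /eqP/dpoly_mulf_eq0[//|/eqP].
Qed.

Lemma poly_inU v (c : K) u :
  poly_in v << c *g u >> = << c *g strip v u >>%:P * 'X^(u v).
Proof.
rewrite /poly_in mmapU /= /mono_in.
by rewrite [LHS]polyC_mulA [in RHS]malgU_scale.
Qed.

Lemma coef_poly_inU v (c : K) u l : (poly_in v << c *g u >>)`_l =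
  if l == u v then << c *g strip v u >> else 0.
Proof. by rewrite poly_inU; apply: coef_CXn. Qed.

Lemma poly_in_coef v f l : poly_in v (poly_in v f)`_l = ((poly_in v f)`_l)%:P.
Proof. by apply: poly_in_free; rewrite coef_poly_in; apply: coefv_free. Qed.

Lemma poly_in_comm v w f k l : w != v ->
  (poly_in w (poly_in v f)`_l)`_k = (poly_in v (poly_in w f)`_k)`_l.
Proof.
have iter_sum x y i j : (poly_in x (poly_in y f)`_i)`_j =
    \sum_(u <- msupp f) (poly_in x (poly_in y << f@_u *g u >>)`_i)`_j.
  have sumE z h k' : (poly_in z h)`_k' =
      \sum_(u <- msupp h) (poly_in z << h@_u *g u >>)`_k'.
    apply: etrans (coef_rmorph_sum (poly_in z) _ _ _).
    exact: (congr1 (fun h => (poly_in z h)`_k') (monalgE h)).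
  apply: etrans (coef_rmorph_sum (poly_in x) _ _ _).
  exact: (congr1 (fun h => (poly_in x h)`_j) (sumE y f i)).
move=> wv; rewrite [LHS]iter_sum [RHS]iter_sum.
apply: eq_bigr => u _; move: (f@_u) => c.
have coef2 x y i j : x != y -> (poly_in x (poly_in y << c *g u >>)`_i)`_j =
    if (i == u y) && (j == u x) then << c *g strip x (strip y u) >> else 0.
  move=> xy; apply: etrans (congr1 (fun h => (poly_in x h)`_j)
                                   (coef_poly_inU y c u i)) _.
  case: (i == u y) => /=; last by rewrite [poly_in x 0]rmorph0 coef0.
  apply: etrans (coef_poly_inU x c _ j) _.
  by rewrite stripE (negPf xy).
apply: etrans (coef2 w v l k wv) _; apply: esym.
apply: etrans (coef2 v w k l _) _; first by rewrite eq_sym.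
rewrite andbC; case: (_ && _); last exact: erefl.
exact: (congr1 (fun k => << c *g k >>) (strip_comm v w u)).
Qed.

Lemma poly_in_dvar_neq v w : w != v -> poly_in v (dvar w) = (dvar w)%:P.
Proof. by move=> wv; apply: poly_in_free; apply: vars_in_dvar. Qed.

Definition dpoly_coordinates : coordinates (dpoly K m n) (derivative m n) :=
  Coordinates horner_poly_in poly_in_dvar poly_in_dvar_neq poly_in_coef
    poly_in_comm.

End Univariate.

(** * Numerical estimates *)

Section Numerics.
Local Open Scope nat_scope.

(** Adding [d] on the left makes the recursion geometric: each step multiplies
    the sum by at most [1 + 2 * b ^ 2], and the exponent [k] of the base by at
    most [2 * b ^ 2]. *)
Lemma saturation_exponent_le b e' d k x (ds : seq nat) :
  0 < b -> e' <= b * b -> size ds <= b -> all (leq^~ b) ds -> 0 < x -> k <= x ->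
  saturation_exponent b e' d k ds + d <=
  (1 + 2 * b ^ 2) ^ size ds * ((2 * b ^ 2) ^ size ds * x + d).
Proof.
move=> b_gt0 le_e'; elim: ds k x => [|D ds IHds] k x /=; first by move=> *; lia.
move=> szds /andP[leD leds] x_gt0 le_kx.
have bb_gt0 : 0 < 2 * b ^ 2 by rewrite muln_gt0 expn_gt0 b_gt0.
have {IHds} := IHds (D * (1 + D * k)) (2 * b ^ 2 * x) (ltnW szds) leds.
rewrite muln_gt0 bb_gt0 => /(_ x_gt0) IHds.
have leDk : D * (1 + D * k) <= 2 * b ^ 2 * x.
  rewrite (@leq_trans (b * (1 + b * x))) //; first by rewrite leq_mul // leq_add2l leq_mul.
  by rewrite expnS expn1; nia.
have {IHds leDk} := IHds leDk; set E := saturation_exponent _ _ _ _ _.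
rewrite !expnS expn0 => IHds; set B := 1 + _ in IHds *.
have leB : 1 + e' + b * size ds <= B by rewrite /B; nia.
have B2 : 2 <= B by rewrite /B; nia.
rewrite (@leq_trans (B * (E + d))) //; first by nia.
rewrite -mulnA leq_pmul2l; last by lia.
apply: leq_trans IHds _; rewrite leq_mul2l; apply/orP; right.
by rewrite leq_add2r mulnCA mulnA.
Qed.

Lemma double_exponent_bound b d r : 0 < b -> r <= b ->
  (1 + 2 * b ^ 2) ^ r * ((2 * b ^ 2) ^ r * 1 + d) <= (2 * b) ^ (4 * b) * d.+1.
Proof.
move=> b_gt0 le_rb; have bb : 0 < (2 * b) ^ 2 by rewrite expn_gt0 muln_gt0 b_gt0.
have pow c : c <= (2 * b) ^ 2 -> c ^ r <= (2 * b) ^ (2 * b).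
  move=> le_c; rewrite expnM (@leq_trans (((2 * b) ^ 2) ^ r)) ?leq_pexp2l //.
  by case: (r) => // r'; rewrite leq_exp2r.
have le1 : (1 + 2 * b ^ 2) ^ r <= (2 * b) ^ (2 * b) by apply: pow; nia.
have le2 : (2 * b ^ 2) ^ r <= (2 * b) ^ (2 * b) by apply: pow; nia.
have -> : (2 * b) ^ (4 * b) = (2 * b) ^ (2 * b) * (2 * b) ^ (2 * b).
  by rewrite -expnD; congr (_ ^ _); lia.
have: 0 < (2 * b) ^ (2 * b) by rewrite expn_gt0 muln_gt0 b_gt0.
move: (_ ^ (2 * b)) le1 le2 => Y le1 le2 Y_gt0.
rewrite muln1 -(mulnA Y Y) leq_mul // mulnS leq_add //.
by rewrite leq_pmull.
Qed.

Lemma leq_zbound k d b : d <= zbound k d b.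
Proof.
elim: k d => //= k IHk d; apply: leq_trans (IHk _).
by rewrite -addnA leq_addl || lia.
Qed.

(** The inner term [G] of the recursion is at least [2 * b * (b + d)], so that
    the base of [dbound] is at least [(2 * b) ^ 2 * d.+1]; it is raised to a power
    at least [2 ^ b], and [2 * 2 ^ b] is at least [4 * b]. *)
Lemma double_exponent_le_zbound b d :
  0 < b -> (2 * b) ^ (4 * b) * d.+1 <= zbound (b + d) d b.
Proof.
move=> b_gt0; rewrite -(prednK b_gt0) addSn (prednK b_gt0) /=.
apply: leq_trans (leq_zbound _ _ _); rewrite -!addnA.
apply: leq_trans (leq_addr _ _); rewrite /dbound.
set G := gbound _ _; set X := _ + d.
have leG : 2 * b * (b + d) <= G.
  rewrite /G /gbound; set M := maxn _ _.
  have leM : 2 * b <= M by rewrite leq_maxr.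
  rewrite leq_mul // (_ : 1 + (b + d - 1) = b + d); last by lia.
  by rewrite -{1}[b + d]expn1 leq_pexp2l; lia.
have leC : 2 <= 'C(2 * b, b).
  case: (b) b_gt0 => // c _; rewrite mulnS binS.
  by rewrite -(addn1 1) leq_add // bin_gt0; lia.
have leX : (2 * b) ^ 2 * d.+1 <= 2 * X.
  rewrite /X; have : 2 * b * (b + d) * 2 * (2 * b) <= (G + (d + 1)) * 'C(2 * b, b) * (2 * b).
    by rewrite leq_mul2r; apply/orP; right; apply: leq_mul => //; lia.
  rewrite -mulnn; nia.
rewrite (@leq_trans (((2 * b) ^ 2 * d.+1) ^ 2 ^ b)) //; last first.
  rewrite (@leq_trans ((2 * X) ^ 2 ^ b)) ?leq_exp2r ?expn_gt0 //.
  rewrite leq_pexp2l //; first by apply: leq_trans leX; rewrite muln_gt0 expn_gt0 muln_gt0 b_gt0.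
  by rewrite leq_exp2l // leq_addr.
have le2b : 2 * b <= 2 ^ b.
  case: (b) b_gt0 => // c _; rewrite expnS leq_mul2l /=.
  exact: ltn_expl.
rewrite (expnMn _ _ (2 ^ b)); apply: leq_mul.
  rewrite -expnM leq_exp2l; first by lia.
  by lia.
by rewrite -{1}[d.+1]expn1 leq_pexp2l // expn_gt0.
Qed.
End Numerics.

(** * Leaders of derivatives of a differential polynomial *)

Section Ranking.
Context {m n : nat}.
Implicit Types (v w : derivative m n) (t : Theta m).

Lemma rank_dact t v : rank (dact t v) =
  [seq x.1 + x.2 | x <- zip (rcons (\sum_(i < m) t i :: [seq t i | i <- enum 'I_m])
                              0) (rank v)] :> seq nat.
Proof.
rewrite /rank /lexkey /dact /= -big_split /=; congr (_ :: _).
  by apply: eq_bigr => i _; rewrite cmM.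
rewrite zip_rcons ?size_map // map_rcons /=; congr (rcons _ _).
by elim: (enum _) => //= i s ->; rewrite cmM.
Qed.

(** The rankings of [dact t v] and [v] differ by a vector that depends on [t]
    only, and lexicographic comparison is invariant under translation. *)
Lemma ltxi_zip_add (c s s' : seq nat) :
  size s = size c -> size s' = size c -> ((s : seqlexi nat) < s')%O ->
  (([seq x.1 + x.2 | x <- zip c s] : seqlexi nat) <
    [seq x.1 + x.2 | x <- zip c s'])%O.
Proof.
elim: c s s' => [|x c IHc] [|y s] [|z s'] //= [szs] [szs'].
rewrite !ltxi_cons !leEnat !leq_add2l => /andP[-> /=] /implyP lt_s.
by apply/implyP => /lt_s; apply: IHc.
Qed.

Lemma size_rank v : size (rank v) = m.+2.
Proof. by rewrite /= size_rcons size_map size_enum_ord. Qed.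

Lemma ltx_dact t v w :
  (rank v < rank w)%O -> (rank (dact t v) < rank (dact t w))%O.
Proof.
move=> lt_vw; rewrite !rank_dact; apply: ltxi_zip_add => //;
  by rewrite size_rank size_rcons /= size_map size_enum_ord.
Qed.

Lemma ltx_dact_proper t v : t <> mone -> (rank v < rank (dact t v))%O.
Proof.
move=> t1; have t_gt0 : 0 < \sum_(i < m) t i.
  rewrite lt0n sum_nat_eq0; apply/negP => /forallP t0; apply: t1.
  by apply/eqP/cmP => i; rewrite cm1; have /= /eqP := t0 i.
rewrite /rank /lexkey ltxi_cons leEnat.
have -> : \sum_(i < m) (dact t v).1 i = \sum_(i < m) t i + \sum_(i < m) v.1 i.
  by rewrite -big_split; apply: eq_bigr => i _; rewrite cmM.
by move: t_gt0; set x := (\sum_i t i)%N; set y := (\sum_i _)%N; case: leqP; lia.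
Qed.

Definition below w : pred (derivative m n) := [pred v | (rank v < rank w)%O].
Definition upto w : pred (derivative m n) := [pred v | (rank v <= rank w)%O].

Lemma below_upto w : {subset below w <= upto w}.
Proof. by move=> v; apply: ltW. Qed.

Lemma upto_below v w : (rank v < rank w)%O -> {subset upto v <= below w}.
Proof. by move=> lt_vw u; rewrite !inE => /le_lt_trans; apply. Qed.

Lemma dact_dact t t' v : dact t (dact t' v) = dact (mmul t t') v.
Proof. by rewrite /dact /= mulmA. Qed.

End Ranking.

Section Leaders.
Local Open Scope fset_scope.
Local Open Scope ring_scope.
Context {K : fieldType} {m n : nat}.
Implicit Types (f g a : dpoly K m n) (v w : derivative m n) (u : dmonom m n).

Lemma below_free f w : f \is a vars_in (below w) -> f \is a free_of w.
Proof.
move=> /allP fP; apply/allP => v /fP lt_vw.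
by apply/negP => /eqP vw; move: lt_vw; rewrite vw /below /= ltxx.
Qed.

Lemma leaderP f w : leader f = Some w -> w \in vars f /\ f \is a vars_in (upto w).
Proof.
rewrite /leader; case fE: [seq _ <- _ | _] => [//|x s] [xw].
have: w \in x :: s by rewrite xw mem_head.
by rewrite -fE mem_filter => /andP[].
Qed.

Lemma leader_eq f w : w \in vars f -> f \is a vars_in (upto w) -> leader f = Some w.
Proof.
move=> wf fw; rewrite /leader.
have -> : [seq v <- vars f | all (fun x => (rank x <= rank v)%O) (vars f)] =
          [seq v <- vars f | v == w].
  apply: eq_in_filter => v vf; apply/idP/eqP => [/allP/(_ w wf) le_wv|->] //.
  by apply/rank_inj/le_anti; rewrite le_wv andbT; move/allP: fw; apply.
by rewrite filter_pred1_uniq // fset_uniq.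
Qed.

Lemma leader_exists f : ~ is_constant f -> exists w, leader f = Some w.
Proof.
move=> fnc; have [v vf] : exists v, v \in vars f.
  apply/fset0Pn; apply/eqP => f0; apply: fnc; exists f@_mone.
  apply/malgP => u; rewrite mcoeffC eq_sym; case: eqVneq => [<-//|u1].
  rewrite mcoeff_outdom //; apply: contra u1 => uf.
  apply/cmP => w; rewrite cm1; apply/esym/eqP/negPn/negP => uw.
  have: w \in vars f by apply/varsP; exists u.
  by rewrite f0 in_fset0.
have maxP (s : seq (derivative m n)) : s != [::] ->
    exists2 w, w \in s & all (fun x => (rank x <= rank w)%O) s.
  elim: s => // x s IHs _.
  have [->|/IHs[w ws /allP w_max]] := eqVneq s [::].
    by exists x; rewrite ?mem_head //= ?lexx.
  have [le_wx|/ltW le_xw] := leP (rank w) (rank x).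
    exists x; rewrite ?mem_head //= lexx; apply/allP => y /w_max.
    by move/le_trans; apply.
  by exists w; rewrite ?inE ?ws ?orbT //= le_xw; apply/allP.
have [|w wf w_max] := maxP (vars f).
  by apply/eqP => f0; move: vf; rewrite -[v \in _]/(v \in (vars f : seq _)) f0.
by exists w; apply: leader_eq.
Qed.

End Leaders.

Section Partial.
Local Open Scope fset_scope.
Local Open Scope ring_scope.
Context {K : fieldType} {m n : nat}.
Implicit Types (f g a : dpoly K m n) (v w : derivative m n) (u : dmonom m n)
  (P : pred (derivative m n)).

(** All properties of [partial] are read off its coefficients: the only monomial
    of [f] whose derivative is a multiple of [u] is [u] times [v]. *)
Lemma mcoeff_partial v f u :
  (partial v f)@_u = f@_(mmul u (ucm v)) *+ (u v).+1.
Proof.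
rewrite /partial raddf_sum /=.
have : forall w, mmul u (ucm v) w = (u w + ucm v w)%N by move=> w; exact: cmM.
move: (mmul _ _) => u' u'E.
have u'v : u' v = (u v).+1 by rewrite u'E ucmE eqxx addn1.
have divE : divcm u' (ucm v) = u.
  apply/eqP/cmP => w; apply: etrans (divcmE _ _ w) _.
  rewrite u'E. exact: addnK.
have other x : x != u' -> << f@_x *+ (x : dmonom m n) v *g divcm x (ucm v) >>@_u = 0 :> K.
  move=> xu'; rewrite mcoeffU; case: eqP => [xE|_]; last exact: mulr0n.
  have [x0|x_gt0] := posnP (x v); first by rewrite x0 mulr0n mul0rn.
  case/eqP: xu'; apply/eqP/cmP => w; rewrite u'E -xE divcmE subnK //.
  by rewrite ucmE; case: eqP => [<-|].
have [u'f|u'f] := boolP (u' \in msupp f).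
  rewrite (big_fsetD1 u' u'f) /= [X in _ + X]big1_seq; last first.
    by move=> x /andP[_]; rewrite in_fsetD1 => /andP[/other].
  rewrite [LHS]addr0 divE u'v; exact: mcoeffUU.
rewrite (mcoeff_outdom u'f) mul0rn big1_seq // => x /andP[_ xf].
by apply: other; apply: contraNneq u'f => <-.
Qed.

Lemma partialD v f g : partial v (f + g) = partial v f + partial v g.
Proof.
apply/malgP => u; apply: etrans (mcoeff_partial v (f + g) u) _.
rewrite [in LHS]mcoeffD; apply: esym.
apply: etrans (mcoeffD u _ _) _.
apply: etrans (congr2 +%R (mcoeff_partial v f u) (mcoeff_partial v g u)) _.
by apply: esym; apply: mulrnDl.
Qed.

Lemma partial_free v f : f \is a free_of v -> partial v f = 0.
Proof.
move=> /vars_inP fv; apply/malgP => u; apply: etrans (mcoeff_partial v f u) _.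
rewrite mcoeff0 mcoeff_outdom ?mul0rn //; apply/negP => uf; have := fv _ uf v.
by rewrite cmM ucmE eqxx addn1 /= eqxx => /(_ isT).
Qed.

Lemma mcoeffM_dvar v a u : (a * dvar v)@_(mmul u (ucm v)) = a@_u.
Proof.
have aE : a * dvar v = \sum_(x <- msupp a) << a@_x *g mmul x (ucm v) >>.
  apply: etrans (congr1 (fun h => h * dvar v) (monalgE a)) _.
  apply: etrans (mulr_suml _ _ _ _) _; apply: eq_bigr => x _.
  by apply: etrans (malgUM _ _ _ _) _; rewrite mulr1.
apply: etrans (congr1 (mcoeff (mmul u (ucm v))) aE) _.
apply: esym; apply: etrans (congr1 (mcoeff u) (monalgE a)) _.
rewrite [LHS]raddf_sum [RHS]raddf_sum; apply: eq_bigr => x _.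
apply: etrans (mcoeffU _ _ _) _; apply: esym; apply: etrans (mcoeffU _ _ _) _.
suff -> : (mmul x (ucm v) == mmul u (ucm v)) = (x == u) by [].
apply/eqP/eqP => [xu|->]; last exact: erefl.
have cmMw y w : mmul y (ucm v) w = (y w + ucm v w)%N := cmM w y (ucm v).
apply/eqP/cmP => w; apply: (@addIn (ucm v w)).
by apply: etrans (esym (cmMw x w)) _; rewrite xu; apply: cmMw.
Qed.

Lemma partial_linear v a : a \is a free_of v -> partial v (a * dvar v) = a.
Proof.
move=> /vars_inP av; apply/malgP => u; apply: etrans (mcoeff_partial v (a * dvar v) u) _.
rewrite mcoeffM_dvar; have [ua|/mcoeff_outdom->] := boolP (u \in msupp a); last exact: mul0rn.
suff -> : u v = 0%N by [].
by apply/eqP/negPn/negP => /(av u ua); rewrite /= eqxx.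
Qed.

Lemma partial_linearD v a b : a \is a free_of v -> b \is a free_of v ->
  partial v (a * dvar v + b) = a.
Proof.
move=> av bv; apply: etrans (partialD _ _ _) _.
apply: etrans (congr2 +%R (partial_linear av) (partial_free bv)) _.
exact: addr0.
Qed.

Lemma msupp_partial v f u : u \in msupp (partial v f) -> mmul u (ucm v) \in msupp f.
Proof.
rewrite -mcoeff_neq0 mcoeff_partial -mcoeff_neq0; apply: contraNneq => ->.
by rewrite mul0rn.
Qed.

Lemma partial_vars_in v f P : f \is a vars_in P -> partial v f \is a vars_in P.
Proof.
move=> /vars_inP fP; apply/vars_inP => u /msupp_partial uf w uw; apply: (fP _ uf).
by rewrite cmM addn_eq0 negb_and uw.
Qed.

Lemma partial_neq0 v f : [pchar K] =i pred0 -> v \in vars f -> partial v f != 0.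
Proof.
move=> charK /varsP[u uf uv]; apply/eqP => fv0.
have := congr1 (mcoeff (divcm u (ucm v))) fv0.
rewrite mcoeff_partial mcoeff0 (_ : mmul _ _ = u); last first.
  apply/eqP/cmP => w; rewrite cmM divcmE subnK // ucmE.
  by case: eqP => // <-; rewrite lt0n.
move=> /eqP; rewrite -mulr_natr mulf_eq0 mcoeff_eq0 uf /=.
by move/pcharf0P: charK => ->.
Qed.

End Partial.

Section Theta.
Local Open Scope fset_scope.
Local Open Scope ring_scope.
Context {K : fieldType} {m n : nat} (delta : 'I_m -> K -> K).
Implicit Types (f g a l : dpoly K m n) (v w mu : derivative m n) (t : Theta m).

Lemma ltx_ucm (i : 'I_m) w : (rank w < rank (dact (ucm i) w))%O.
Proof.
apply: ltx_dact_proper => /(congr1 (fun t : Theta m => t i)).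
by rewrite ucmE eqxx cm1.
Qed.

(** Only the chain-rule term of the highest derivative [w] of [f] reaches the
    derivative [delta_i w]. *)
Lemma pder_top i f w : f \is a vars_in (upto w) ->
  pder delta i f - partial w f * dvar (dact (ucm i) w)
    \is a vars_in (below (dact (ucm i) w)).
Proof.
move=> fw; have low := upto_below (ltx_ucm i w).
have fw' := vars_in_sub low fw; rewrite /pder -addrA; apply: rpredD.
  rewrite big_seq; apply: rpred_sum => u uf; apply: vars_in_monomial => v uv.
  by apply: low; apply: (vars_inP _ _ fw u uf).
have lower v : v \in vars f -> v != w ->
    partial v f * dvar (dact (ucm i) v) \is a vars_in (below (dact (ucm i) w)).
  move=> vf vw; apply: rpredM; first exact: partial_vars_in.
  apply: vars_in_dvar; apply: ltx_dact; rewrite lt_neqAle.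
  rewrite (inj_eq rank_inj) vw /=; exact: (allP fw).
have [wf|wf] := boolP (w \in vars f).
  rewrite (big_fsetD1 w wf) /= addrAC subrr add0r big_seq.
  by apply: rpred_sum => v; rewrite in_fsetD1 => /andP[vw vf]; apply: lower.
have -> : partial w f = 0.
  apply: partial_free; apply/allP => v vf; apply: contraNneq wf => <-.
  exact: vf.
rewrite mul0r subr0 big_seq; apply: rpred_sum => v vf; apply: lower => //.
by apply: contraNneq wf => <-.
Qed.

(** The shape of [theta l] when [w] is [theta mu]: the derivatives are linear
    in their leader, with the separant of [l] as coefficient; for [theta = 1]
    only the partial derivative is known. *)
Definition derived l mu f w :=
  [/\ f \is a vars_in (upto w), partial w f = partial mu l, (rank mu <= rank w)%O &
      w = mu \/
      exists2 a, a \is a vars_in (below w) & f = partial mu l * dvar w + a].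

Lemma derived_linear l mu w a : l \is a vars_in (upto mu) ->
  (rank mu < rank w)%O -> a \is a vars_in (below w) ->
  derived l mu (partial mu l * dvar w + a) w.
Proof.
move=> lmu lt_w aP; have sP : partial mu l \is a vars_in (below w).
  by apply: vars_in_sub (partial_vars_in mu lmu); apply: upto_below.
split; last by right; exists a.
- apply: rpredD; last exact: (vars_in_sub (@below_upto _ _ w) aP).
  apply: rpredM; first exact: (vars_in_sub (@below_upto _ _ w) sP).
  by apply: vars_in_dvar; apply: lexx.
- apply: partial_linearD; first exact: below_free sP.
  exact: below_free aP.
- exact: ltW lt_w.
Qed.

Lemma derived_pder l mu f w i : l \is a vars_in (upto mu) ->
  derived l mu f w -> derived l mu (pder delta i f) (dact (ucm i) w).
Proof.
move=> lmu [fw pf le_mu _].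
have := pder_top i fw; rewrite pf => aP.
rewrite -(addr_subKC (pder delta i f) (partial mu l * dvar (dact (ucm i) w))).
exact: (derived_linear lmu (le_lt_trans le_mu (ltx_ucm i w)) aP).
Qed.

Lemma dact1 w : dact mone w = w.
Proof. by case: w => k r; rewrite /dact mul1m. Qed.

Lemma derived_theta l mu t : l \is a vars_in (upto mu) ->
  derived l mu (theta_act delta t l) (dact t mu).
Proof.
move=> lmu; have [t' t'E] : exists t' : seq 'I_m -> Theta m, forall s : seq 'I_m, uniq s ->
    derived l mu (foldr (fun i h => iter (t i) (pder delta i) h) l s)
      (dact (t' s) mu) /\ forall j, t' s j = if j \in s then t j else 0%N.
  exists (foldr (fun i t' => iter (t i) (mmul (ucm i)) t') mone).
  elim=> [|i s IHs] /= => [_|/andP[is_s /IHs{IHs}[]]].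
    by split=> [|j]; [rewrite dact1; split=> //; left|rewrite cm1].
  set f := foldr _ l s; set k := foldr _ mone s => fk kE; split.
    elim: (t i) => [|j IHj]; first exact: fk.
    by have := derived_pder i lmu IHj; rewrite dact_dact.
  move=> j; rewrite inE.
  have -> : forall c, (iter c (mmul (ucm i)) k : Theta m) j = ((i == j) * c + k j)%N.
    elim=> [|c IHc] /=; first by rewrite muln0.
    by rewrite cmM ucmE IHc mulnS addnA.
  rewrite kE eq_sym; have [->|_] := eqVneq j i; last by rewrite mul0n.
  by rewrite (negPf is_s) mul1n addn0.
have [dt tE] := t'E _ (enum_uniq 'I_m).
have tt' : t' (enum 'I_m) = t by apply/eqP/cmP => j; rewrite tE mem_enum.
by rewrite tt' in dt.
Qed.

Lemma theta_act_top l mu t : leader l = Some mu -> t <> mone ->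
  exists2 a, a \is a vars_in (below (dact t mu)) &
    theta_act delta t l = separant l * dvar (dact t mu) + a.
Proof.
move=> lmu t1; rewrite /separant lmu.
have [_ lP] := leaderP lmu; have [_ _ _ [mut|//]] := derived_theta t lP.
by have := ltx_dact_proper mu t1; rewrite mut ltxx.
Qed.

Lemma theta_act_upto l mu t : leader l = Some mu ->
  theta_act delta t l \is a vars_in (upto (dact t mu)).
Proof. by move=> /leaderP[_ lP]; have [] := derived_theta t lP. Qed.

(** In characteristic 0 the separant of [l] does not vanish, so that [dact t mu]
    does occur in the derivative. *)
Lemma leader_theta_act l mu t : [pchar K] =i pred0 -> leader l = Some mu ->
  leader (theta_act delta t l) = Some (dact t mu).
Proof.
move=> charK lmu; have [muP lP] := leaderP lmu.
have [tP pE _ _] := derived_theta t lP; apply: (leader_eq _ tP).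
apply/negPn/negP => nt; move/eqP: (partial_neq0 charK muP); apply.
rewrite -pE; apply: partial_free; apply/allP => v vf.
by apply: contraNneq nt => <-.
Qed.

End Theta.

(** * Rosenfeld's lemma *)

Lemma linear_relation (A : comNzRingType) (I : A -> Prop) (x y q h s z c : A) :
  (I (x * (y - q * h)) -> h = s * z + c -> I (x * y - x * q * (s * z + c)))%R.
Proof. by move=> + hE; rewrite mulrBr hE mulrA. Qed.

Section Rosenfeld.
Local Open Scope fset_scope.
Local Open Scope ring_scope.
Context {K : fieldType} {m n : nat} (delta : 'I_m -> K -> K).
Implicit Types (f g h l r : dpoly K m n) (v w mu : derivative m n) (t : Theta m)
  (L : {fset dpoly K m n}).

Lemma degv_gt0 v f : v \in vars f -> (0 < degv v f)%N.
Proof.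
move=> /varsP[u uf uv]; apply: leq_trans (_ : u v <= _)%N; first by rewrite lt0n.
exact: (@degv_leP _ _ _ v f u uf).
Qed.

Lemma vars_degv_gt0 v f : (0 < degv v f)%N -> v \in vars f.
Proof.
move=> f_gt0; apply/negPn/negP => vf; move: f_gt0; rewrite ltnNge; case/negP.
rewrite /degv; apply/bigmax_leqP_seq => u uf _.
by rewrite leqn0; apply: contraNT vf => uv; apply/varsP; exists u.
Qed.

Lemma separant_vars_in P l : l \is a vars_in P -> separant l \is a vars_in P.
Proof.
move=> lP; rewrite /separant; case: (leader l) => [v|]; last exact: rpred0.
exact: partial_vars_in.
Qed.

Lemma initial_vars_in P l : l \is a vars_in P -> initial l \is a vars_in P.
Proof.
move=> lP; rewrite /initial; case: (leader l) => [v|]; last exact: rpred0.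
by apply: vars_in_sub (coefv_vars_in v _ lP) => w /andP[].
Qed.

Lemma HL_vars_in P L : {in L, forall l, l \is a vars_in P} -> HL L \is a vars_in P.
Proof.
move=> LP; rewrite /HL big_seq; apply: rpred_prod => l /LP lP.
by apply: rpredM; [apply: initial_vars_in|apply: separant_vars_in].
Qed.

Lemma HL_factor L l : l \in L ->
  exists a, HL L = initial l * separant l * a.
Proof. by move=> lL; exists (\prod_(l' <- L `\ l) (initial l' * separant l'));
  exact: big_fsetD1. Qed.

Lemma HL_separant L l : l \in L -> exists a, HL L = separant l * a.
Proof.
move=> /HL_factor[a HE]; exists (initial l * a); apply: etrans HE _.
exact: mulr_swap.
Qed.

Lemma HL_initial L l : l \in L -> exists a, HL L = initial l * a.
Proof.
move=> /HL_factor[a HE]; exists (separant l * a); apply: etrans HE _.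
exact: esym (mulrA _ _ _).
Qed.

(** The descent on the leaders needs an absolute bound [k] on them, whereas the
    bound in [Lprolong] is relative to each element of [L]. *)
Definition prolonged L k h : Prop := h \in L \/
  exists l t mu, [/\ l \in L, leader l = Some mu, t <> mone,
    (ovar (dact t mu) < k)%N & h = theta_act delta t l].

Lemma ovar_inj : injective (@ovar m n).
Proof.
move=> v w vw; apply: rank_inj; apply: le_anti.
by rewrite !leNgt -!ovar_lt vw ltnn.
Qed.

(** A proper derivative of a leader is too high to occur in the same element,
    and occurs in no other one because [L] is autoreduced. *)
Lemma autoreduced_free L l l0 mu t : autoreduced L -> l \in L -> l0 \in L ->
  leader l0 = Some mu -> t <> mone -> l \is a free_of (dact t mu).
Proof.
move=> [_ Lred] lL l0L l0mu t1; have [->|/eqP ll0] := eqVneq l l0.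
  have [_ lmu] := leaderP l0mu; apply: below_free.
  by apply: vars_in_sub lmu; apply: upto_below; apply: ltx_dact_proper.
have [lpr _] := Lred l l0 lL l0L ll0; apply/allP => v vl.
apply/negP => /eqP vE; have /negP[] := lpr mu l0mu (dact t mu) (ex_intro _ t (conj t1 erefl)).
by rewrite -vE.
Qed.

Lemma prolonged_free L l0 mu t h : autoreduced L -> l0 \in L ->
  leader l0 = Some mu -> t <> mone -> prolonged L (ovar (dact t mu)) h ->
  h \is a free_of (dact t mu).
Proof.
move=> Lauto l0L l0mu t1 [hL|[l [t' [mu' [lL lmu' t'1 lt_k ->]]]]].
  exact: (autoreduced_free Lauto hL l0L l0mu t1).
apply: below_free; apply: vars_in_sub (theta_act_upto delta t' lmu').
by apply: upto_below; rewrite -ovar_lt.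
Qed.

(** Each step of a pseudodivision multiplies by an initial or a separant, which
    divide [HL L], and subtracts a multiple of a polynomial whose leader occurs
    in the current remainder, so is lower than [v]. *)
Lemma rem_steps_satur L v r r' : rem_steps delta L r r' ->
  r \is a vars_in (below v) ->
  satur (HL L) (ideal_gen (prolonged L (ovar v))) r' ->
  satur (HL L) (ideal_gen (prolonged L (ovar v))) r.
Proof.
set I := ideal_gen _; have idI : ideal I by exact: ideal_gen_ideal.
have idJ := satur_ideal (HL L) idI; set J := satur _ _ in idJ *.
have coef_in P w e f : f \is a vars_in P -> coefv w e f \is a vars_in P.
  by move=> fP; apply: vars_in_sub (coefv_vars_in w e fP) => x /andP[].
elim=> {r r'} [r0 _ Jr0|r r' r'' step _ IHr rv Jr'']; first exact: Jr0.
move: step IHr; case=> [v' l mu t lL [mu' lmu' obs] _ lmu t1 v'E|v' l lL [mu' lmu' obs] _ lv'] IHr.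
- have mumu : mu' = mu by apply: Some_inj; rewrite -lmu' lmu.
  have v'r : v' \in vars r.
    case: obs => [[]//|[v'mu _]]; have := ltx_dact_proper mu t1.
    by rewrite -v'E v'mu mumu ltxx.
  have lt_v' : (rank v' < rank v)%O := allP rv _ v'r.
  have v'v := upto_below lt_v'.
  have [_ lP] := leaderP lmu.
  have lt_mu : (rank mu < rank v)%O.
    by apply: lt_trans lt_v'; rewrite v'E; apply: ltx_dact_proper.
  have thetaJ : J (theta_act delta t l).
    apply: satur_sub; apply: ideal_gen_mem; right; exists l, t, mu.
    by split=> //; rewrite -v'E ovar_lt.
  have [a HE] := HL_separant lL; apply: (satur_cancel idI HE).
  apply: (ideal_subK idJ) (ideal_mull idJ _ thetaJ).
  apply: IHr Jr''; apply: rpredB.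
    apply: rpredM rv; apply: separant_vars_in.
    by apply: vars_in_sub lP; apply: upto_below.
  apply: rpredM.
    by apply: rpredM; [apply: coef_in|apply: rpredX; apply: vars_in_dvar].
  rewrite v'E in v'v; exact: (vars_in_sub v'v (theta_act_upto delta t lmu)).
- have [v'l lP] := leaderP lv'.
  have v'r : v' \in vars r.
    case: obs => [[]//|[_ le_deg]]; apply: vars_degv_gt0.
    by apply: leq_trans le_deg; apply: degv_gt0.
  have lt_v' : (rank v' < rank v)%O := allP rv _ v'r.
  have v'v := upto_below lt_v'; have lv := vars_in_sub v'v lP.
  have lJ : J l by apply: satur_sub; apply: ideal_gen_mem; left.
  have [a HE] := HL_initial lL; apply: (satur_cancel idI HE).
  apply: (ideal_subK idJ) (ideal_mull idJ _ lJ).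
  apply: IHr Jr''; apply: rpredB.
    by apply: rpredM rv; apply: initial_vars_in.
  apply: rpredM lv.
  by apply: rpredM; [apply: coef_in|apply: rpredX; apply: vars_in_dvar].
Qed.

(** If [v] is the derivative of index [k], one generator [h0] with leader [v] is
    kept: by coherence, the saturated ideal of the lower generators and [h0]
    contains the other ones.  Then [v] occurs linearly in [h0] and nowhere
    else. *)
Lemma rosenfeld_step L k g : [pchar K] =i pred0 -> autoreduced L ->
  reduction_coherent delta L -> partially_reduced_set g L ->
  satur (HL L) (ideal_gen (prolonged L k.+1)) g ->
  satur (HL L) (ideal_gen (prolonged L k)) g.
Proof.
move=> charK Lauto Lcoh gpr; set H := HL L; set I := ideal_gen (prolonged L k).
have idI : ideal I by exact: ideal_gen_ideal.
have idJ := satur_ideal H idI; set J := satur H I in idJ *.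
have [[l0 [t0 [mu0 [l0L l0mu t01 v0]]]]|none] := classic (exists l t mu,
    [/\ l \in L, leader l = Some mu, t <> mone & ovar (dact t mu) = k]); last first.
  apply: satur_sub_satur; apply: ideal_gen_least => // h hk.
  apply: satur_sub; apply: ideal_gen_mem.
  case: hk => [hL|[l [t [mu [lL lmu t1 lt_k hE]]]]]; first by left.
  right; exists l, t, mu; split=> //.
  move: lt_k; rewrite ltnS leq_eqVlt => /orP[/eqP vk|//].
  by case: none; exists l, t, mu.
set v := dact t0 mu0 in v0; set h0 := theta_act delta t0 l0.
have [a0 a0P h0E] := theta_act_top delta l0mu t01.
have [c0 Hs0] := HL_separant l0L.
pose W := adjoin J h0; have idW : ideal W by exact: adjoin_ideal.
have gen_W h : prolonged L k.+1 h -> satur H W h.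
  move=> hk; case: (hk) => [hL|[l [t [mu [lL lmu t1 lt_k hE]]]]].
    by apply: satur_sub; apply: adjoin_sub; apply: satur_sub; apply: ideal_gen_mem; left.
  move: lt_k; rewrite ltnS leq_eqVlt => /orP[/eqP vk|lt_k]; last first.
    apply: satur_sub; apply: adjoin_sub; apply: satur_sub; apply: ideal_gen_mem.
    by right; exists l, t, mu.
  have vE : dact t mu = v by apply: ovar_inj; rewrite vk.
  have [a aP] := theta_act_top delta lmu t1; rewrite -hE vE => hE'.
  apply: (satur_cancel idW Hs0); apply: satur_sub.
  exists (separant l).
  have spE : separant l0 * h - separant l * h0 = Spoly delta l l0 t0 t.
    by rewrite hE.
  have lv : leader (theta_act delta t l) = Some v.
    exact: (etrans (leader_theta_act delta t charK lmu) (congr1 Some vE)).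
  have l0v : leader (theta_act delta t0 l0) = Some v.
    exact: (leader_theta_act delta t0 charK l0mu).
  have [rs _] := Lcoh l l0 lL l0L t0 t v lv l0v.
  have sub l' mu' t' : leader l' = Some mu' -> t' <> mone -> dact t' mu' = v ->
      separant l' \is a vars_in (below v).
    move=> /leaderP[_ l'P] t'1 <-; apply: separant_vars_in.
    by apply: vars_in_sub l'P; apply: upto_below; apply: ltx_dact_proper.
  have spP : separant l0 * h - separant l * h0 \is a vars_in (below v).
    rewrite hE' /h0 h0E cross_cancel; apply: rpredB; apply: rpredM.
    - exact: (sub _ _ _ l0mu t01 erefl).
    - by rewrite vE in aP.
    - exact: (sub _ _ _ lmu t1 vE).
    - exact: a0P.
  rewrite spE in spP *; have := rem_steps_satur rs spP; rewrite v0; apply.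
  exact: ideal_0 idJ.
move=> /(satur_sub_satur (ideal_gen_least (satur_ideal H idW) gen_W)).
case=> N [q [M IM]].
have freeI f : prolonged L k f -> const_along dpoly_coordinates v f.
  rewrite -v0 => fk; apply: poly_in_free.
  exact: (prolonged_free Lauto l0L l0mu t01 fk).
have Hfree : H \is a free_of v.
  apply: HL_vars_in => l lL; exact: (autoreduced_free Lauto lL l0L l0mu t01).
have gfree : g \is a free_of v.
  apply/allP => x xg; apply/negP => /eqP xv.
  have /negP[] := gpr l0 l0L mu0 l0mu v (ex_intro _ t0 (conj t01 erefl)).
  by rewrite -xv.
have [s0P a0free] : separant l0 \is a free_of v /\ a0 \is a free_of v.
  split; last exact: below_free a0P.
  apply: separant_vars_in; exact: (autoreduced_free Lauto l0L l0L l0mu t01).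
have constHg : const_along dpoly_coordinates v (H ^+ M * (H ^+ N * g)).
  apply: const_alongM; first exact/const_alongX/poly_in_free.
  by apply: const_alongM; [exact/const_alongX/poly_in_free|exact: poly_in_free].
have [j Ij] := eliminate_linear idI (stable_ideal_gen freeI) constHg
  (poly_in_free s0P) (poly_in_free a0free) (linear_relation IM h0E).
have := satur_expr_factor idI Hs0 Ij.
by move=> /satur_expr /satur_expr.
Qed.

End Rosenfeld.

(** * The triangular system of an autoreduced set *)

Section Assembly.
Local Open Scope fset_scope.
Local Open Scope ring_scope.
Context {K : fieldType} {m n : nat}.
Implicit Types (f g h l : dpoly K m n) (v w mu : derivative m n) (t : Theta m)
  (L : {fset dpoly K m n}).
Local Notation DC := (@dpoly_coordinates K m n).

Lemma theta_act1 (delta : 'I_m -> K -> K) l : theta_act delta mone l = l.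
Proof.
rewrite /theta_act; elim: (enum _) => //= i s IHs.
by rewrite cm1.
Qed.

Lemma ovar_gt0 v : (0 < ovar v)%N.
Proof.
have [s [_ <- sv]] := ovar_enum v; have := sv v; rewrite lexx.
by case: s {sv}.
Qed.

Lemma opolE l mu : leader l = Some mu -> opol l = ovar mu.
Proof. by rewrite /opol => ->. Qed.

(** The leaders that occur in [Lprolong] have an index at most [b + d], from
    where [rosenfeld_step] descends to [L] itself. *)
Lemma rosenfeld (delta : 'I_m -> K -> K) b d L g :
  [pchar K] =i pred0 -> (forall l, l \in L -> bounded b l) ->
  autoreduced L -> reduction_coherent delta L -> partially_reduced_set g L ->
  satur (HL L) (ideal_gen (Lprolong delta L d)) g ->
  satur (HL L) (ideal_gen (fun h => h \in L)) g.
Proof.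
move=> charK Lb Lauto Lcoh gpr.
have sub h : Lprolong delta L d h -> prolonged delta L (b + d).+1 h.
  move=> [l [t [lL le_o ->]]]; have [mu lmu] := leader_exists (Lauto.1 l lL).
  have [t1|/eqP t1] := eqVneq t mone; first by left; rewrite t1 theta_act1.
  right; exists l, t, mu; split=> //.
  move: le_o; rewrite (opolE (leader_theta_act delta t charK lmu)) (opolE lmu) ltnS.
  move=> /leq_trans; apply; rewrite leq_add2r.
  by have [muP _] := leaderP lmu; have [bv _] := Lb l lL; apply: bv.
move=> [N gN]; have : satur (HL L) (ideal_gen (prolonged delta L (b + d).+1)) g.
  exists N; move: gN; apply: ideal_gen_least; first exact: ideal_gen_ideal.
  by move=> h /sub; apply: ideal_gen_mem.
elim: (b + d).+1 => [|k IHk]; last by move/(rosenfeld_step charK Lauto Lcoh gpr).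
apply: satur_sub_satur; apply: ideal_gen_least.
  exact/satur_ideal/ideal_gen_ideal.
move=> h [hL|[l [t [mu []]]] //].
by apply: satur_sub; apply: ideal_gen_mem.
Qed.

Lemma degv_le_bounded v b f : bounded b f -> degv_le v b f.
Proof.
move=> [_ fb] u uf; rewrite -ltnS (leq_trans _ fb) //.
apply: leq_ltn_trans (msize_mdeg_lt uf); rewrite mdegE.
have [vu|] := boolP (v \in finsupp u); first by rewrite (big_fsetD1 v) //= leq_addr.
by rewrite -cmE_eq0 => /eqP ->.
Qed.

Lemma separant_degv_le v b f : degv_le v b f -> degv_le v b (separant f).
Proof.
rewrite /separant => fb; case: (leader f) => [w|]; last by move=> u; rewrite msupp0.
move=> u /msupp_partial /fb; apply: leq_trans; rewrite cmM; exact: leq_addr.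
Qed.

Lemma deg_le_prod (C : comNzRingType) (V : eqType) (S : coordinates C V) (v : V)
    e (T : eqType) (r : seq T) (F : T -> C) :
  {in r, forall i, deg_le S v e (F i)} ->
  deg_le S v (size r * e) (\prod_(i <- r) F i).
Proof.
elim: r => [|i r IHr] Fe.
  by rewrite big_nil /deg_le rmorph1 size_poly1.
rewrite big_cons mulSn; apply: deg_leM; first by apply: Fe; rewrite mem_head.
by apply: IHr => j jr; apply: Fe; rewrite inE jr orbT.
Qed.

(** Two elements with the same leader would each have a lower degree in it than
    the other. *)
Lemma opol_inj L : autoreduced L -> {in L &, injective (@opol K m n)}.
Proof.
move=> Lauto l l' lL l'L; have [mu lmu] := leader_exists (Lauto.1 l lL).
have [mu' lmu'] := leader_exists (Lauto.1 l' l'L).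
rewrite (opolE lmu) (opolE lmu') => /ovar_inj mumu'; rewrite -mumu' in lmu'.
apply/eqP/negPn/negP => /eqP ll'.
have [_ /(_ mu lmu')] := Lauto.2 l l' lL l'L ll'.
have [_ /(_ mu lmu)] := Lauto.2 l' l l'L lL (not_eq_sym ll').
by move=> /ltn_trans h /h; rewrite ltnn.
Qed.

Lemma card_autoreduced b L : (forall l, l \in L -> bounded b l) ->
  autoreduced L -> (#|` L| <= b)%N.
Proof.
move=> Lb Lauto; rewrite -(size_map (@opol K m n)) -[b](size_iota 1).
apply: uniq_leq_size.
  by rewrite map_inj_in_uniq ?fset_uniq //; apply: opol_inj.
move=> _ /mapP[l lL ->]; have [mu lmu] := leader_exists (Lauto.1 l lL).
rewrite (opolE lmu) mem_iota ovar_gt0 add1n ltnS.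
by have [muP _] := leaderP lmu; have [bv _] := Lb l lL; apply: bv.
Qed.

Section Steps.
Variables (L : {fset dpoly K m n}) (b d : nat) (v0 : derivative m n).
Hypotheses (Lb : forall l, l \in L -> bounded b l) (Lauto : autoreduced L).

(** The default [v0] is never reached, as the elements of [L] have leaders. *)
Definition step_of l : @step (dpoly K m n) (derivative m n) :=
  let v := odflt v0 (leader l) in (v, degv v l, poly_in v l).

Definition sorted_elements : seq (dpoly K m n) :=
  sort (fun l l' => opol l <= opol l')%N L.

Definition steps := map step_of sorted_elements.

Lemma mem_sorted_elements l : (l \in sorted_elements) = (l \in L).
Proof. exact: mem_sort. Qed.

Lemma step_value_of l : step_value DC (step_of l) = l.
Proof. exact: horner_poly_in. Qed.

Lemma step_initial_of l : l \in L -> step_initial (step_of l) = initial l.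
Proof.
move=> lL; have [mu lmu] := leader_exists (Lauto.1 l lL).
rewrite /initial /step_of lmu; exact: coef_poly_in.
Qed.

Lemma HL_steps : HL L =
  (\prod_(l <- L) separant l) * \prod_(t <- steps) step_initial t.
Proof.
have -> : \prod_(t <- steps) step_initial t = \prod_(l <- L) initial l.
  rewrite big_map; apply: etrans (perm_big _ (permEl (perm_sort _ _))) _.
  rewrite big_seq [RHS]big_seq; apply: eq_bigr => l; exact: step_initial_of.
rewrite /HL [LHS]big_split /=; exact: mulrC.
Qed.

Lemma sysideal_steps f : ideal_gen (fun h => h \in L) f <->
  sysideal DC (eq^~ 0) steps f.
Proof.
have id0 := @zero_ideal (dpoly K m n); split.
  apply: ideal_gen_least; first exact: sysideal_ideal.
  move=> l; rewrite -mem_sorted_elements => lL; rewrite -[l]step_value_of.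
  by apply: sysideal_mem => //; apply: map_f.
apply: sysideal_least => [|_ ->|_ /mapP[l lL ->]].
- exact: ideal_gen_ideal.
- exact: ideal_0 (ideal_gen_ideal _).
- rewrite step_value_of; apply: ideal_gen_mem.
  by rewrite -mem_sorted_elements.
Qed.

Lemma step_deg_le l : l \in L -> (step_deg (step_of l) <= b)%N.
Proof.
move=> lL; have lb v := degv_le_bounded v (Lb lL).
rewrite /step_deg /= /degv; apply/bigmax_leqP_seq => u uf _.
exact: lb.
Qed.

Lemma triangular_steps : triangular DC b steps.
Proof.
have: {subset sorted_elements <= L} by move=> l; rewrite mem_sorted_elements.
have: pairwise (fun l l' => opol l <= opol l')%N sorted_elements.
  rewrite -sorted_pairwise; last by move=> x y z; apply: leq_trans.
  by apply: sort_sorted => x y; apply: leq_total.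
have: uniq sorted_elements by rewrite sort_uniq fset_uniq.
rewrite /steps; elim: sorted_elements => // l s IHs.
rewrite [uniq _]/= [pairwise _ _]/= => /andP[ls us] /andP[/allP le_ls pws] sL.
have lL : l \in L by apply: sL; rewrite mem_head.
have [mu lmu] := leader_exists (Lauto.1 l lL); have [muP lP] := leaderP lmu.
have sE : step_of l = (mu, degv mu l, poly_in mu l) by rewrite /step_of lmu.
have sL' : {subset s <= L} by move=> x xs; apply: sL; rewrite inE xs orbT.
rewrite [map _ _]/= sE; split.
- exact: degv_gt0.
- exact: (size_poly_in (@degv_leP _ _ _ mu l)).
- move=> i; exact: (const_along_coef DC).
- move=> _ /mapP[l' l's ->]; have l'L := sL' _ l's.
  have [mu' lmu'] := leader_exists (Lauto.1 l' l'L).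
  have sE' : step_of l' = (mu', degv mu' l', poly_in mu' l').
    by rewrite /step_of lmu'.
  have lt_mu : (rank mu < rank mu')%O.
    rewrite -ovar_lt -(opolE lmu) -(opolE lmu') ltn_neqAle le_ls // andbT.
    apply: contraNneq ls => /(opol_inj Lauto lL l'L) ->.
    exact: l's.
  rewrite sE'; split.
  + by apply: contraTneq lt_mu; rewrite /step_var /= => ->; rewrite ltxx.
  + move=> i; apply: (const_along_coef_other (S := DC)); apply: poly_in_free.
    by apply: below_free; apply: vars_in_sub lP; apply: upto_below.
  + move=> i; apply: (deg_le_coef_along (S := DC)); apply: size_poly_in.
    exact: degv_le_bounded (Lb l'L).
- exact: IHs.
Qed.

(** The cofactor of the initials in [HL L] is the product of the separants, of
    degree at most [#|` L| * b] in each leader. *)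
Lemma autoreduced_saturation g N : (0 < b)%N -> bounded d g ->
  ideal_gen (fun h => h \in L) (HL L ^+ N * g) ->
  ideal_gen (fun h => h \in L) (HL L ^+ zbound (b + d) d b * g).
Proof.
move=> b_gt0 gd /sysideal_steps; rewrite HL_steps.
have le_b := card_autoreduced Lb Lauto.
have idS := sysideal_ideal DC steps (@zero_ideal (dpoly K m n)).
have stab : {in steps, forall u, stable DC (step_var u) (eq^~ 0)}.
  by move=> t _; apply: stable_zero.
have sep_deg : {in steps, forall u, deg_le DC (step_var u) (#|` L| * b)
                     (\prod_(l <- L) separant l)}.
  move=> t _; apply: deg_le_prod => l lL; apply: size_poly_in.
  apply: separant_degv_le; exact: degv_le_bounded (Lb lL).
have g_deg : {in steps, forall u, deg_le DC (step_var u) d g}.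
  by move=> t _; apply: size_poly_in; apply: degv_le_bounded.
move=> /(triangular_saturation (@zero_ideal _) stab (@torsion_exponent_zero K m n)
  triangular_steps sep_deg g_deg) gI.
apply/sysideal_steps; apply: (ideal_expr_le idS _ gI).
set ds := map _ _; have szds : size ds = #|` L| by rewrite !size_map size_sort.
have ds_b : all (leq^~ b) ds.
  apply/allP => _ /mapP[_ /mapP[l lL ->] ->]; apply: step_deg_le.
  by rewrite -mem_sorted_elements.
apply: leq_trans (double_exponent_le_zbound d b_gt0).
have le_e' : (#|` L| * b <= b * b)%N by rewrite leq_mul2r le_b orbT.
have := @saturation_exponent_le b (#|` L| * b) d 1 1 ds b_gt0 le_e'.
rewrite szds => /(_ le_b ds_b isT isT) le_E.
apply: leq_trans (leq_addr d _) (leq_trans le_E _).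
exact: double_exponent_bound.
Qed.

End Steps.

End Assembly.

Theorem lemma5p45 (K : fieldType) (m n : nat) (delta : 'I_m -> K -> K)
  (charK : [pchar K]%R =i pred0) (m_gt0 : 0 < m) (n_gt0 : 0 < n)
  (delta_der : forall i, is_derivation (delta i))
  (delta_comm : forall i j x, delta i (delta j x) = delta j (delta i x))
  (b d : nat) (L : {fset dpoly K m n}%fset) (g : dpoly K m n)
  (L_bounded : forall l, l \in L -> bounded b l)
  (L_autoreduced : autoreduced L)
  (L_coherent : reduction_coherent delta L)
  (g_ideal : ideal_gen (LHdiff delta L d) g)
  (g_bounded : bounded d g)
  (g_preduced : partially_reduced_set g L) :
  ideal_gen (LHalg L (zbound (b + d) d b)) g.
Proof.
have g_satur : ideal_gen (Lprolong delta L d) (HL L ^+ d * g)%R.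
  move: g_ideal; apply: (ideal_gen_least (colon_power_ideal (HL L) d
                           (ideal_gen_ideal (Lprolong delta L d)))).
  by move=> h [].
apply: ideal_gen_mem; split.
  have le_d := leq_zbound (b + d) d b; case: g_bounded => gv gs; split.
    by move=> v /gv /leq_trans; apply.
  by apply: leq_trans gs _; rewrite ltnS.
(* For [b = 0] the set [L] is empty, [HL L] is 1 and [g] vanishes. *)
have [b0|b_gt0] := posnP b; last first.
  have [N gN] := rosenfeld charK L_bounded L_autoreduced L_coherent g_preduced
    (ex_intro _ d g_satur).
  exact: (autoreduced_saturation (mone, Ordinal n_gt0) L_bounded L_autoreduced
            b_gt0 g_bounded gN).
have L0 l : l \notin L.
  apply/negP => lL; have [mu /leaderP[muP _]] := leader_exists (L_autoreduced.1 l lL).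
  by have [/(_ mu muP)] := L_bounded l lL; rewrite b0 leqNgt ovar_gt0.
have HL1 : HL L = 1%R.
  by rewrite /HL big1_seq // => l /andP[_ lL]; have := L0 l; rewrite lL.
have g0 : (HL L ^+ d * g)%R = 0%R.
  move: g_satur; apply: (ideal_gen_least (@zero_ideal _)).
  by move=> h [l [t [lL]]]; have := L0 l; rewrite lL.
have -> : (HL L ^+ zbound (b + d) d b * g)%R = 0%R.
  move: g0; rewrite HL1 !expr1n !mul1r; exact.
exact: ideal_0 (ideal_gen_ideal _).
Qed.
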